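(* Consider the planar Stark problem $$\ddot x=-\frac{x}{r^3}+1,\qquad \ddot y=-\frac{y}{r^3},\qquad r=\sqrt{x^2+y^2}.$$ For any $a\in(0,1)$ there exist $k_p\in\mathbb N$ and real numbers $\{b_k\}_{k\ge k_p}$, $\{b'_k\}_{k\ge k_p}$ such that, letting $A_k$ and $B_k$ denote the solutions with initial position $(x(0),y(0))=(a,0)$ and initial velocities $(\dot x(0),\dot y(0))=(0,b_k)$ and $(0,b'_k)$ respectively, the following hold: (i) $A_k$ is a periodic orbit which (for $t>0$) intersects the positive $x$-axis $k$ times and then intersects the negative $x$-axis perpendicularly; (ii) $B_k$ is a collision orbit which (for $t>0$) intersects the positive $x$-axis $k$ times before collision with the origin; (iii) $\lim_{k\to+\infty}b_k=\lim_{k\to+\infty}b'_k=\sqrt{\tfrac{2}{a}-2a}$, and $\lim_{a\to1}k_p=+\infty$, where $k_p=k_p(a)$ is taken as small as possible; (iv) $b_k<b'_k$ and $b'_k<b_{k+1}$ for all $k\ge k_p$.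
   Context: The positive (resp. negative) $x$-axis is $\{(x,0):x>0\}$ (resp. $\{(x,0):x<0\}$). A collision orbit is a solution reaching the origin in finite time. *)

(* Defs.v *)
From Stdlib Require Import Reals.
From Coquelicot Require Import Coquelicot.
Open Scope R_scope.

Definition rad (x y : R) : R := sqrt (x ^ 2 + y ^ 2).

Definition stark_solution (D : R -> Prop) (x y vx vy : R -> R) : Prop :=
  forall t, D t ->
    0 < rad (x t) (y t) /\
    is_derive x t (vx t) /\
    is_derive y t (vy t) /\
    is_derive vx t (- x t / (rad (x t) (y t)) ^ 3 + 1) /\
    is_derive vy t (- y t / (rad (x t) (y t)) ^ 3).

Definition exactly_k_times (P : R -> Prop) (k : nat) : Prop :=
  exists ts : nat -> R,
    (forall i j : nat, (i < j < k)%nat -> ts i < ts j) /\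
    (forall t, P t <-> exists i : nat, (i < k)%nat /\ t = ts i).

Definition init_cond (a b : R) (x y vx vy : R -> R) : Prop :=
  x 0 = a /\ y 0 = 0 /\ vx 0 = 0 /\ vy 0 = b.

Definition periodic_orbit_k (a b : R) (k : nat) : Prop :=
  exists x y vx vy : R -> R,
    stark_solution (fun _ => True) x y vx vy /\
    init_cond a b x y vx vy /\
    (exists P, 0 < P /\ forall t, x (t + P) = x t /\ y (t + P) = y t) /\
    exists T, 0 < T /\
      exactly_k_times (fun t => 0 < t < T /\ y t = 0 /\ 0 < x t) k /\
      (forall t, 0 < t < T -> ~ (y t = 0 /\ x t < 0)) /\
      y T = 0 /\ x T < 0 /\ vx T = 0 /\ vy T <> 0.

Definition collision_orbit_k (a b : R) (k : nat) : Prop :=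
  exists x y vx vy : R -> R, exists lo Tc : R,
    lo < 0 < Tc /\
    stark_solution (fun t => lo < t < Tc) x y vx vy /\
    init_cond a b x y vx vy /\
    filterlim (fun t => rad (x t) (y t)) (at_left Tc) (locally 0) /\
    exactly_k_times (fun t => 0 < t < Tc /\ y t = 0 /\ 0 < x t) k.

Definition stark_families (a : R) (kp : nat) (b b' : nat -> R) : Prop :=
  (forall k, (kp <= k)%nat -> periodic_orbit_k a (b k) k) /\
  (forall k, (kp <= k)%nat -> collision_orbit_k a (b' k) k) /\
  is_lim_seq b (sqrt (2 / a - 2 * a)) /\
  is_lim_seq b' (sqrt (2 / a - 2 * a)) /\
  (forall k, (kp <= k)%nat -> b k < b' k /\ b' k < b (S k)).

(* Main.v *)
Require Import Defs.
From Stdlib Require Import Reals ZArith Lra Lia List ClassicalEpsilon.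
From Coquelicot Require Import Coquelicot.
Open Scope R_scope.

(** The substitution x + i y = (u + i v)^2, dt = (u^2 + v^2) dtau separates the problem
    into two one-dimensional oscillators. For an orbit launched from (a, 0) with velocity
    (0, b), u starts at rest at its maximum sqrt a and v starts at 0. The positive x-axis
    is crossed when v = 0, the negative one when u = 0, and u = v = 0 is a collision.
    Writing u = sqrt a cos th and v = B sin ph, both angles solve an equation
    th' = sqrt ((s + m sin^2 th) / 2), so they are inverses of explicit integrals. Let
    w(b) be the ratio of the quarter periods of u and v: then w(b) = 2k+1 yields a periodic
    orbit A_k and w(b) = 2k+2 a collision orbit B_k. At the critical velocity
    sqrt (2/a - 2a) the point sqrt a becomes the saddle of the u-oscillator, so w tends to
    infinity there, and b_k, b'_k are taken to be the last points where w <= 2k+1, 2k+2.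

    As a tends to 1, p = u^2 = (r + x)/2 satisfies (r p')^2 = 2 p (p - a) (p + a + E),
    where E is the energy. If E > -2a, then p cannot reach 0. Otherwise p starts so close
    to the saddle -a - E that, by a Gronwall estimate, it stays above 1/2 for a long time,
    during which y'' = - y / r^3 with r bounded forces y to vanish many times. *)

(** * Calculus on the line: mean values, intermediate values, integrals *)

Lemma is_derive_continuity_pt (f : R -> R) (x l : R) :
  is_derive f x l -> continuity_pt f x.
Proof.
  intros H. apply derivable_continuous_pt. exists l. now apply is_derive_Reals.
Qed.

Lemma is_derive_eq (f : R -> R) (x l l' : R) :
  is_derive f x l -> l = l' -> is_derive f x l'.
Proof. now intros H <-. Qed.

Lemma mean_value (f df : R -> R) (a b : R) :
  a <= b -> (forall x, a <= x <= b -> is_derive f x (df x)) ->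
  exists c, a <= c <= b /\ f b - f a = df c * (b - a).
Proof.
  intros Hab Hd.
  destruct (MVT_gen f a b df) as [c Hc].
  - rewrite Rmin_left, Rmax_right by lra. intros x Hx. apply Hd. lra.
  - rewrite Rmin_left, Rmax_right by lra. intros x Hx.
    apply is_derive_continuity_pt with (df x), Hd, Hx.
  - rewrite Rmin_left, Rmax_right in Hc by lra. now exists c.
Qed.

Lemma derive_nonneg_le (f df : R -> R) (a b : R) :
  a <= b -> (forall x, a <= x <= b -> is_derive f x (df x)) ->
  (forall x, a <= x <= b -> 0 <= df x) -> f a <= f b.
Proof.
  intros Hab Hd Hp. destruct (mean_value f df a b Hab Hd) as [c [Hc E]].
  specialize (Hp c Hc). nra.
Qed.

Lemma derive_pos_lt (f df : R -> R) (a b : R) :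
  a < b -> (forall x, a <= x <= b -> is_derive f x (df x)) ->
  (forall x, a <= x <= b -> 0 < df x) -> f a < f b.
Proof.
  intros Hab Hd Hp. destruct (mean_value f df a b) as [c [Hc E]]; trivial.
  - lra.
  - specialize (Hp c Hc). nra.
Qed.

Lemma derive_zero_const (f : R -> R) (x y : R) :
  (forall z, is_derive f z 0) -> f x = f y.
Proof.
  intros Hd.
  assert (H : forall a b, a <= b -> f a = f b).
  { intros a b Hab. destruct (mean_value f (fun _ => 0) a b Hab) as [c [_ E]].
    - intros z _. apply Hd.
    - lra. }
  destruct (Rle_dec x y); [ | symmetry]; apply H; lra.
Qed.

Lemma intermediate_value (f : R -> R) (a b w : R) :
  a <= b -> (forall x, continuity_pt f x) ->
  f a <= w <= f b \/ f b <= w <= f a ->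
  exists x, a <= x <= b /\ f x = w.
Proof.
  intros Hab Hc Hw.
  destruct (IVT_gen f a b w) as [x Hx].
  - exact Hc.
  - destruct Hw; [rewrite Rmin_left, Rmax_right | rewrite Rmin_right, Rmax_left];
      lra.
  - rewrite Rmin_left, Rmax_right in Hx by lra. now exists x.
Qed.

Lemma RInt_is_derive (f : R -> R) (a : R) :
  (forall x, continuous f x) -> forall x, is_derive (RInt f a) x (f x).
Proof.
  intros Hc x. apply is_derive_RInt with a; trivial.
  apply filter_forall. intros y. apply (RInt_correct f).
  apply (ex_RInt_continuous f). intros; apply Hc.
Qed.

Lemma RInt_self (f : R -> R) (a : R) : RInt f a a = 0.
Proof. apply (RInt_point a f). Qed.

(** * Inverses of increasing functions with a translation symmetry *)

Lemma shift_iter (F : R -> R) (p P : R) :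
  (forall x, F (x + p) = F x + P) ->
  forall (n : nat) x, F (x + INR n * p) = F x + INR n * P.
Proof.
  intros H n. induction n as [|n IH]; intros x.
  - simpl. rewrite !Rmult_0_l, !Rplus_0_r. trivial.
  - rewrite S_INR. replace (x + (INR n + 1) * p) with (x + INR n * p + p) by ring.
    rewrite H, IH. ring.
Qed.

Lemma shift_iter_Z (F : R -> R) (p P : R) :
  (forall x, F (x + p) = F x + P) ->
  forall (n : Z) x, F (x + IZR n * p) = F x + IZR n * P.
Proof.
  intros H n x. destruct (Z_le_gt_dec 0 n) as [Hn|Hn].
  - rewrite <- (Z2Nat.id n), <- INR_IZR_INZ by lia. now apply shift_iter.
  - replace n with (- Z.of_nat (Z.to_nat (- n)))%Z by lia.
    rewrite opp_IZR, <- INR_IZR_INZ. set (m := Z.to_nat (- n)).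
    generalize (shift_iter F p P H m (x + - INR m * p)).
    replace (x + - INR m * p + INR m * p) with x by ring. lra.
Qed.

Lemma shift_unbounded (F : R -> R) (p P M : R) :
  0 < P -> (forall x, F (x + p) = F x + P) ->
  (exists x, F x <= M) /\ (exists x, M <= F x).
Proof.
  intros HP H. set (n := up ((M - F 0) / P)).
  destruct (archimed ((M - F 0) / P)) as [H1 H2]. fold n in H1, H2.
  assert (E : (M - F 0) / P * P = M - F 0) by (field; lra).
  split.
  - exists (0 + IZR (n - 1) * p). rewrite (shift_iter_Z F p P H), minus_IZR. nra.
  - exists (0 + IZR n * p). rewrite (shift_iter_Z F p P H). nra.
Qed.

Definition inverse_pair (F G : R -> R) : Prop :=
  (forall x, G (F x) = x) /\ (forall y, F (G y) = y).

(** The shift relation makes [F] unbounded in both directions, hence onto by intermediate values;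
    strict growth makes preimages unique, so choosing one defines [G]. *)
Lemma incr_shift_inverse (F : R -> R) (p P : R) :
  (forall x y, x < y -> F x < F y) -> (forall x, continuity_pt F x) ->
  0 < P -> (forall x, F (x + p) = F x + P) ->
  exists G, inverse_pair F G.
Proof.
  intros Hi Hc HP Hs.
  assert (Hex : forall y, exists x, F x = y).
  { intros y. destruct (shift_unbounded F p P y HP Hs) as [[x1 H1] [x2 H2]].
    destruct (Rle_dec x1 x2) as [Hx|Hx].
    - destruct (intermediate_value F x1 x2 y Hx Hc) as [x [_ Hx']]; [lra | now exists x].
    - assert (F x2 < F x1) by (apply Hi; lra). lra. }
  exists (fun y => proj1_sig (constructive_indefinite_description _ (Hex y))).
  assert (HG : forall y,
    F (proj1_sig (constructive_indefinite_description _ (Hex y))) = y).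
  { intros y. apply (proj2_sig (constructive_indefinite_description _ (Hex y))). }
  split; trivial. intros x.
  set (z := proj1_sig _). assert (E : F z = F x) by apply HG.
  destruct (Rtotal_order z x) as [H|[H|H]]; trivial; apply Hi in H; lra.
Qed.

Lemma inverse_incr (F G : R -> R) (x y : R) :
  (forall x y, x < y -> F x < F y) -> inverse_pair F G -> x < y -> G x < G y.
Proof.
  intros F_incr [GF HFG] Hxy.
  destruct (Rlt_le_dec (G x) (G y)) as [H|H]; trivial.
  destruct H as [H|H].
  - apply F_incr in H. rewrite !HFG in H. lra.
  - apply (f_equal F) in H. rewrite !HFG in H. lra.
Qed.

Lemma inverse_shift (F G : R -> R) (p P : R) :
  inverse_pair F G -> (forall x, F (x + p) = F x + P) -> forall y, G (y + P) = G y + p.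
Proof.
  intros [GF HFG] Hs y.
  rewrite <- (GF (G y + p)), Hs, HFG. trivial.
Qed.

Lemma inverse_continuous (F G : R -> R) (y : R) :
  (forall x y, x < y -> F x < F y) -> inverse_pair F G -> continuity_pt G y.
Proof.
  intros F_incr FG. assert (G_incr := inverse_incr F G).
  destruct (FG) as [GF HFG].
  intros eps Heps.
  assert (H1 : F (G y - eps) < y).
  { rewrite <- (HFG y) at 2. apply F_incr. lra. }
  assert (H2 : y < F (G y + eps)).
  { rewrite <- (HFG y) at 1. apply F_incr. lra. }
  exists (Rmin (y - F (G y - eps)) (F (G y + eps) - y)).
  split; [apply Rmin_pos; lra |].
  intros z [_ Hz]. simpl in *. unfold R_dist in *.
  apply Rabs_def2 in Hz.
  assert (B1 := Rmin_l (y - F (G y - eps)) (F (G y + eps) - y)).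
  assert (B2 := Rmin_r (y - F (G y - eps)) (F (G y + eps) - y)).
  apply Rabs_def1.
  - assert (G z < G (F (G y + eps))) by (apply G_incr; trivial; lra).
    rewrite GF in *. lra.
  - assert (G (F (G y - eps)) < G z) by (apply G_incr; trivial; lra).
    rewrite GF in *. lra.
Qed.

(** The difference quotient of [G] with step [h] is the reciprocal of that of [F] with step
    [k = G (y + h) - G y]. This [k] is nonzero since [F] undoes [G], and small by continuity of
    [G]. *)
Lemma inverse_derive (F G : R -> R) (y l : R) :
  (forall x y, x < y -> F x < F y) -> inverse_pair F G ->
  is_derive F (G y) l -> l <> 0 -> is_derive G y (/ l).
Proof.
  intros F_incr FG Hd Hl. destruct (FG) as [GF HFG]. apply is_derive_Reals in Hd.
  apply is_derive_Reals.
  set (q := fun h => (F (G y + h) - F (G y)) / h).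
  assert (Hq : forall eps, 0 < eps -> exists d, 0 < d /\
    forall h, h <> 0 -> Rabs h < d -> Rabs (/ q h - / l) < eps).
  { assert (Hlim : limit1_in q (fun h => h <> 0) l 0).
    { intros eps He. destruct (Hd eps He) as [d Hd']. exists d.
      split; [apply cond_pos|]. intros h [Hh Hh']. simpl in *.
      unfold R_dist in *. apply Hd'; trivial. rewrite Rminus_0_r in Hh'. trivial. }
    apply limit_inv in Hlim; trivial.
    intros eps He. destruct (Hlim eps He) as [d [Hd0 Hd']]. exists d.
    split; trivial. intros h Hh Hh'. apply (Hd' h). split; trivial.
    simpl. unfold R_dist. now rewrite Rminus_0_r. }
  intros eps He. destruct (Hq eps He) as [d [Hd0 Hd']].
  destruct (inverse_continuous F G y F_incr FG d Hd0) as [d' [Hd'0 Hc]].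
  exists (mkposreal d' Hd'0). intros h Hh Hh'. simpl in Hh'.
  set (k := G (y + h) - G y).
  assert (Hk : k <> 0).
  { intros E. apply Hh. assert (E' : G (y + h) = G y) by (unfold k in E; lra).
    apply (f_equal F) in E'. rewrite !HFG in E'. lra. }
  assert (Hkd : Rabs k < d).
  { apply (Hc (y + h)). split.
    - split; [exact I | lra].
    - simpl. unfold R_dist. now replace (y + h - y) with h by ring. }
  specialize (Hd' k Hk Hkd).
  assert (E : / q k = k / h).
  { unfold q. replace (G y + k) with (G (y + h)) by (unfold k; ring).
    rewrite !HFG. replace (y + h - y) with h by ring. field. split; trivial. }
  rewrite E in Hd'. exact Hd'.
Qed.

(** * Elliptic integrals for the angles of the two oscillators *)

Definition phase_speed (s m x : R) : R := sqrt ((s + m * sin x ^ 2) / 2).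

Definition phase_time (s m : R) : R -> R := RInt (fun x => / phase_speed s m x) 0.

(** For [0 < s] this is sqrt(2/s) K(-m/s), with K the complete elliptic integral of the first kind
    as a function of its parameter. *)
Definition quarter (s m : R) : R := phase_time s m (PI / 2).

Lemma sin_sqr_bounds (x : R) : 0 <= sin x ^ 2 <= 1.
Proof. generalize (sin2_cos2 x). unfold Rsqr. nra. Qed.

Lemma phase_speed_pos (s m x : R) : 0 < s -> 0 <= m -> 0 < phase_speed s m x.
Proof.
  intros Hs Hm. apply sqrt_lt_R0. generalize (sin_sqr_bounds x). nra.
Qed.

Lemma phase_speed_sqr (s m x : R) : 0 < s -> 0 <= m ->
  phase_speed s m x * phase_speed s m x = (s + m * sin x ^ 2) / 2.
Proof.
  intros Hs Hm. apply sqrt_sqrt. generalize (sin_sqr_bounds x). nra.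
Qed.

Lemma is_derive_phase_speed (s m x : R) : 0 < s -> 0 <= m ->
  is_derive (phase_speed s m) x (m * sin x * cos x / (2 * phase_speed s m x)).
Proof.
  intros Hs Hm. assert (Hp := phase_speed_pos s m x Hs Hm).
  unfold phase_speed in *. auto_derive.
  - generalize (sin_sqr_bounds x). simpl. nra.
  - simpl in *. unfold Rdiv in *. rewrite ?Rmult_1_r in *. field. lra.
Qed.

Lemma is_derive_phase_time (s m x : R) : 0 < s -> 0 <= m ->
  is_derive (phase_time s m) x (/ phase_speed s m x).
Proof.
  intros Hs Hm. unfold phase_time.
  apply (RInt_is_derive (fun x => / phase_speed s m x)). intros z.
  apply (ex_derive_continuous (fun x => / phase_speed s m x)).
  eexists. apply (is_derive_inv (phase_speed s m)).
  - now apply is_derive_phase_speed.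
  - generalize (phase_speed_pos s m z Hs Hm). lra.
Qed.

Lemma phase_time_0 (s m : R) : phase_time s m 0 = 0.
Proof. apply RInt_self. Qed.

Lemma phase_time_incr (s m : R) : 0 < s -> 0 <= m ->
  forall x y, x < y -> phase_time s m x < phase_time s m y.
Proof.
  intros Hs Hm x y Hxy.
  apply derive_pos_lt with (fun x => / phase_speed s m x); trivial; intros z _.
  - now apply is_derive_phase_time.
  - now apply Rinv_0_lt_compat, phase_speed_pos.
Qed.

Lemma quarter_pos (s m : R) : 0 < s -> 0 <= m -> 0 < quarter s m.
Proof.
  intros Hs Hm. rewrite <- (phase_time_0 s m). apply phase_time_incr; trivial.
  generalize PI_RGT_0. lra.
Qed.

Lemma phase_time_odd (s m x : R) : 0 < s -> 0 <= m ->
  phase_time s m (- x) = - phase_time s m x.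
Proof.
  intros Hs Hm.
  set (f := fun x => phase_time s m (- x) + phase_time s m x).
  assert (Hf : forall z, is_derive f z 0).
  { intros z.
    apply is_derive_eq with (- 1 * / phase_speed s m (- z) + / phase_speed s m z).
    - apply (is_derive_plus (fun x => phase_time s m (- x)) (phase_time s m)).
      + apply (is_derive_comp (phase_time s m) (fun x => - x)).
        * now apply is_derive_phase_time.
        * auto_derive; trivial.
      + now apply is_derive_phase_time.
    - unfold phase_speed. rewrite sin_neg.
      replace ((- sin z) ^ 2) with (sin z ^ 2) by ring. ring. }
  assert (H := derive_zero_const f x 0 Hf). unfold f in H.
  rewrite Ropp_0, phase_time_0 in H. lra.
Qed.

(** The integrand depends on the angle through sin^2 only, so the difference of the two phase times
    is constant; evaluated at -PI/2, oddness turns it into two quarters. *)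
Lemma phase_time_shift (s m x : R) : 0 < s -> 0 <= m ->
  phase_time s m (x + PI) = phase_time s m x + 2 * quarter s m.
Proof.
  intros Hs Hm.
  set (f := fun x => phase_time s m (x + PI) - phase_time s m x).
  assert (Hf : forall z, is_derive f z 0).
  { intros z.
    apply is_derive_eq with (1 * / phase_speed s m (z + PI) - / phase_speed s m z).
    - apply (is_derive_minus (fun x => phase_time s m (x + PI)) (phase_time s m)).
      + apply (is_derive_comp (phase_time s m) (fun x => x + PI)).
        * now apply is_derive_phase_time.
        * auto_derive; trivial.
      + now apply is_derive_phase_time.
    - unfold phase_speed. rewrite neg_sin.
      replace ((- sin z) ^ 2) with (sin z ^ 2) by ring. ring. }
  assert (H := derive_zero_const f x (- (PI / 2)) Hf). unfold f in H.
  replace (- (PI / 2) + PI) with (PI / 2) in H by field.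
  rewrite phase_time_odd in H by trivial. unfold quarter. lra.
Qed.

Lemma phase_time_shift_nat (s m x : R) (n : nat) : 0 < s -> 0 <= m ->
  phase_time s m (x + INR n * PI) = phase_time s m x + INR n * (2 * quarter s m).
Proof.
  intros Hs Hm. apply shift_iter. intros y. now apply phase_time_shift.
Qed.

Lemma phase_time_shift_Z (s m x : R) (n : Z) : 0 < s -> 0 <= m ->
  phase_time s m (x + IZR n * PI) = phase_time s m x + IZR n * (2 * quarter s m).
Proof.
  intros Hs Hm. apply shift_iter_Z. intros y. now apply phase_time_shift.
Qed.

Lemma phase_time_half_pi (s m : R) (n : nat) : 0 < s -> 0 <= m ->
  phase_time s m (INR n * (PI / 2)) = INR n * quarter s m.
Proof.
  intros Hs Hm. destruct (Nat.Even_or_Odd n) as [[j ->]|[j ->]].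
  - replace (INR (2 * j) * (PI / 2)) with (0 + INR j * PI)
      by (rewrite mult_INR; simpl; field).
    rewrite phase_time_shift_nat, phase_time_0, mult_INR by trivial. simpl. ring.
  - replace (INR (2 * j + 1) * (PI / 2)) with (PI / 2 + INR j * PI)
      by (rewrite plus_INR, mult_INR; simpl; field).
    rewrite phase_time_shift_nat, plus_INR, mult_INR by trivial.
    unfold quarter. simpl. ring.
Qed.

Lemma phase_exists (s m : R) : 0 < s -> 0 <= m ->
  exists th, inverse_pair (phase_time s m) th.
Proof.
  intros Hs Hm. apply incr_shift_inverse with PI (2 * quarter s m).
  - now apply phase_time_incr.
  - intros x. eapply is_derive_continuity_pt. now apply is_derive_phase_time.
  - generalize (quarter_pos s m Hs Hm). lra.
  - intros x. now apply phase_time_shift.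
Qed.

Lemma is_derive_phase (s m : R) (th : R -> R) (x : R) : 0 < s -> 0 <= m ->
  inverse_pair (phase_time s m) th -> is_derive th x (phase_speed s m (th x)).
Proof.
  intros Hs Hm Hth. assert (Hp := phase_speed_pos s m (th x) Hs Hm).
  rewrite <- (Rinv_inv (phase_speed s m (th x))).
  apply inverse_derive with (phase_time s m); trivial.
  - now apply phase_time_incr.
  - now apply is_derive_phase_time.
  - apply Rgt_not_eq, Rinv_0_lt_compat, Hp.
Qed.

(** Differentiating the speed divides by the speed, which cancels against the angular velocity. When
    [A ^ 2 = m], the second derivative becomes the cubic force -(s/2 + m) u + u^3 in u = A cos
    th. *)
Lemma is_derive_cos_phase (s m A : R) (th : R -> R) (x : R) : 0 < s -> 0 <= m ->
  inverse_pair (phase_time s m) th ->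
  is_derive (fun t => A * cos (th t)) x
    (- A * sin (th x) * phase_speed s m (th x)) /\
  is_derive (fun t => - A * sin (th t) * phase_speed s m (th t)) x
    (- A * cos (th x) * (s + 2 * m * sin (th x) ^ 2) / 2).
Proof.
  intros Hs Hm Hth. assert (Hd := is_derive_phase s m th x Hs Hm Hth).
  assert (Hp := phase_speed_pos s m (th x) Hs Hm).
  assert (Hq := phase_speed_sqr s m (th x) Hs Hm).
  assert (Hds := is_derive_phase_speed s m (th x) Hs Hm).
  split.
  - apply is_derive_eq with
      (phase_speed s m (th x) * (A * - sin (th x))); [|ring].
    apply (is_derive_comp (fun z => A * cos z) th); trivial.
    auto_derive; trivial. ring.
  - apply is_derive_eq with (phase_speed s m (th x) *
      (- A * cos (th x) * phase_speed s m (th x) + - A * sin (th x) *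
       (m * sin (th x) * cos (th x) / (2 * phase_speed s m (th x))))).
    + apply (is_derive_comp (fun z => - A * sin z * phase_speed s m z) th); trivial.
      apply (is_derive_mult (fun z => - A * sin z) (phase_speed s m)); trivial.
      * auto_derive; trivial. ring.
      * intros; apply Rmult_comm.
    + transitivity (- A * cos (th x) * (phase_speed s m (th x) * phase_speed s m (th x)
        + m * sin (th x) ^ 2 / 2)); [field; lra|].
      rewrite Hq. field.
Qed.

Lemma is_derive_sin_phase (s m A : R) (th : R -> R) (x : R) : 0 < s -> 0 <= m ->
  inverse_pair (phase_time s m) th ->
  is_derive (fun t => A * sin (th t)) x
    (A * cos (th x) * phase_speed s m (th x)) /\
  is_derive (fun t => A * cos (th t) * phase_speed s m (th t)) x
    (- A * sin (th x) * (s - m + 2 * m * sin (th x) ^ 2) / 2).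
Proof.
  intros Hs Hm Hth. assert (Hd := is_derive_phase s m th x Hs Hm Hth).
  assert (Hp := phase_speed_pos s m (th x) Hs Hm).
  assert (Hq := phase_speed_sqr s m (th x) Hs Hm).
  assert (Hds := is_derive_phase_speed s m (th x) Hs Hm).
  assert (Hsc := sin2_cos2 (th x)). unfold Rsqr in Hsc.
  split.
  - apply is_derive_eq with
      (phase_speed s m (th x) * (A * cos (th x))); [|ring].
    apply (is_derive_comp (fun z => A * sin z) th); trivial.
    auto_derive; trivial. ring.
  - apply is_derive_eq with (phase_speed s m (th x) *
      (- A * sin (th x) * phase_speed s m (th x) + A * cos (th x) *
       (m * sin (th x) * cos (th x) / (2 * phase_speed s m (th x))))).
    + apply (is_derive_comp (fun z => A * cos z * phase_speed s m z) th); trivial.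
      apply (is_derive_mult (fun z => A * cos z) (phase_speed s m)); trivial.
      * auto_derive; trivial. ring.
      * intros; apply Rmult_comm.
    + transitivity (- A * sin (th x) * (phase_speed s m (th x) * phase_speed s m (th x)
        - m * (cos (th x) * cos (th x)) / 2)); [field; lra|].
      rewrite Hq. replace (cos (th x) * cos (th x)) with (1 - sin (th x) * sin (th x))
        by lra. field.
Qed.

(** * Levi-Civita regularisation *)

(* [tau] is the regularised time as a function of physical time. *)
Lemma levi_civita (u u1 v v1 tau : R -> R) (c t : R) :
  let w := tau t in let rho := u w ^ 2 + v w ^ 2 in
  0 < rho ->
  is_derive tau t (/ rho) ->
  is_derive u w (u1 w) -> is_derive u1 w (- (c / 2) * u w + u w ^ 3) ->
  is_derive v w (v1 w) -> is_derive v1 w (- (c / 2) * v w - v w ^ 3) ->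
  2 * (u1 w ^ 2 + v1 w ^ 2) = 1 + u w ^ 4 - v w ^ 4 - c * rho ->
  let r z := u z ^ 2 + v z ^ 2 in
  let x s := u (tau s) ^ 2 - v (tau s) ^ 2 in
  let y s := 2 * u (tau s) * v (tau s) in
  let vx s := 2 * (u (tau s) * u1 (tau s) - v (tau s) * v1 (tau s)) / r (tau s) in
  let vy s := 2 * (u1 (tau s) * v (tau s) + u (tau s) * v1 (tau s)) / r (tau s) in
  is_derive x t (vx t) /\ is_derive y t (vy t) /\
  is_derive vx t (- x t / rho ^ 3 + 1) /\ is_derive vy t (- y t / rho ^ 3).
Proof.
  intros w rho Hr Ht Hu Hu1 Hv Hv1 HE r x y vx vy.
  set (X := fun z => u z ^ 2 - v z ^ 2). set (Y := fun z => 2 * u z * v z).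
  set (VX := fun z => 2 * (u z * u1 z - v z * v1 z) / r z).
  set (VY := fun z => 2 * (u1 z * v z + u z * v1 z) / r z).
  set (u2 := - (c / 2) * u w + u w ^ 3) in *.
  set (v2 := - (c / 2) * v w - v w ^ 3) in *.
  assert (chain : forall (f : R -> R) l l', is_derive f w l -> / rho * l = l' ->
            is_derive (fun s => f (tau s)) t l').
  { intros f l l' Hf <-. now apply (is_derive_comp f tau). }
  assert (Eu := is_derive_unique _ _ _ Hu). assert (Ev := is_derive_unique _ _ _ Hv).
  assert (Eu1 := is_derive_unique _ _ _ Hu1).
  assert (Ev1 := is_derive_unique _ _ _ Hv1).
  assert (xu : ex_derive u w) by (eexists; apply Hu).
  assert (xv : ex_derive v w) by (eexists; apply Hv).
  assert (xu1 : ex_derive u1 w) by (eexists; apply Hu1).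
  assert (xv1 : ex_derive v1 w) by (eexists; apply Hv1).
  assert (HX : is_derive X w (2 * u w * u1 w - 2 * v w * v1 w)).
  { unfold X. auto_derive; [tauto|].
    change (Derive (fun x => u x) w) with (Derive u w).
    change (Derive (fun x => v x) w) with (Derive v w).
    rewrite Eu, Ev. ring. }
  assert (HY : is_derive Y w (2 * u1 w * v w + 2 * u w * v1 w)).
  { unfold Y. auto_derive; [tauto|].
    change (Derive (fun x => u x) w) with (Derive u w).
    change (Derive (fun x => v x) w) with (Derive v w).
    rewrite Eu, Ev. ring. }
  assert (HVX : is_derive VX w
    ((2 * (u1 w * u1 w + u w * u2 - (v1 w * v1 w + v w * v2)) * rho
      - 2 * (u w * u1 w - v w * v1 w) * (2 * u w * u1 w + 2 * v w * v1 w)) / rho ^ 2)).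
  { unfold VX, r. auto_derive.
    - repeat split; trivial. unfold rho in Hr. simpl in Hr. lra.
    - change (Derive (fun x => u x) w) with (Derive u w).
      change (Derive (fun x => v x) w) with (Derive v w).
      change (Derive (fun x => u1 x) w) with (Derive u1 w).
      change (Derive (fun x => v1 x) w) with (Derive v1 w).
      rewrite Eu, Ev, Eu1, Ev1. unfold rho in *. field. simpl in Hr |- *. lra. }
  assert (HVY : is_derive VY w
    ((2 * (u2 * v w + 2 * u1 w * v1 w + u w * v2) * rho
      - 2 * (u1 w * v w + u w * v1 w) * (2 * u w * u1 w + 2 * v w * v1 w)) / rho ^ 2)).
  { unfold VY, r. auto_derive.
    - repeat split; trivial. unfold rho in Hr. simpl in Hr. lra.
    - change (Derive (fun x => u x) w) with (Derive u w).
      change (Derive (fun x => v x) w) with (Derive v w).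
      change (Derive (fun x => u1 x) w) with (Derive u1 w).
      change (Derive (fun x => v1 x) w) with (Derive v1 w).
      rewrite Eu, Ev, Eu1, Ev1. unfold rho in *. field. simpl in Hr |- *. lra. }
  split; [|split; [|split]].
  - apply (chain X _ _ HX). unfold vx, r. fold w. fold rho. field. lra.
  - apply (chain Y _ _ HY). unfold vy, r. fold w. fold rho. field. lra.
  - apply (chain VX _ _ HVX). unfold x. fold w.
    (* The velocities enter the numerator only through the kinetic term 2(u1^2 + v1^2), which the
       energy relation [HE] then eliminates. *)
    assert (K : 2 * (u1 w * u1 w + u w * u2 - (v1 w * v1 w + v w * v2)) * rho
      - 2 * (u w * u1 w - v w * v1 w) * (2 * u w * u1 w + 2 * v w * v1 w)
      = - (u w ^ 2 - v w ^ 2) + rho ^ 3).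
    { transitivity (- (2 * (u1 w ^ 2 + v1 w ^ 2)) * (u w ^ 2 - v w ^ 2)
        + 2 * rho * (u w * u2 - v w * v2)); [unfold rho; ring|].
      rewrite HE. unfold u2, v2, rho. field. }
    rewrite K. field. lra.
  - apply (chain VY _ _ HVY). unfold y. fold w.
    assert (K : 2 * (u2 * v w + 2 * u1 w * v1 w + u w * v2) * rho
      - 2 * (u1 w * v w + u w * v1 w) * (2 * u w * u1 w + 2 * v w * v1 w)
      = - (2 * u w * v w)).
    { transitivity (- (2 * (u1 w ^ 2 + v1 w ^ 2)) * (2 * u w * v w)
        + 2 * rho * (u2 * v w + u w * v2)); [unfold rho; ring|].
      rewrite HE. unfold u2, v2, rho. field. }
    rewrite K. field. lra.
Qed.

Lemma rad_levi_civita (u v : R) : rad (u ^ 2 - v ^ 2) (2 * u * v) = u ^ 2 + v ^ 2.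
Proof.
  unfold rad. replace ((u ^ 2 - v ^ 2) ^ 2 + (2 * u * v) ^ 2)
    with ((u ^ 2 + v ^ 2) ^ 2) by ring.
  apply sqrt_pow2. nra.
Qed.

Lemma cos_shift_Z (x : R) (n : Z) : cos (x + IZR n * (2 * PI)) = cos x.
Proof.
  rewrite (shift_iter_Z cos (2 * PI) 0); [ring|].
  intros y. rewrite cos_plus, cos_2PI, sin_2PI. ring.
Qed.

Lemma sin_shift_Z (x : R) (n : Z) : sin (x + IZR n * (2 * PI)) = sin x.
Proof.
  rewrite (shift_iter_Z sin (2 * PI) 0); [ring|].
  intros y. rewrite sin_plus, cos_2PI, sin_2PI. ring.
Qed.

(** * Orbits whose oscillator periods are commensurable *)

Section ResonantOrbit.

Variables a b s C m : R.
Variable j : nat.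
Hypothesis a_pos : 0 < a.
Hypothesis b_pos : 0 < b.
Hypothesis s_pos : 0 < s.
Hypothesis C_pos : 0 < C.
Hypothesis m_pos : 0 < m.
(** The oscillators satisfy 2 u'^2 = (a - u^2)(s + a - u^2) and 2 v'^2 = (m - v^2)(C + v^2).
    [same_energy] gives both the same linear coefficient, [separation] makes their constants add up
    to the strength 1 of the attraction, and [launch] encodes the initial speed. *)
Hypothesis same_energy : s + 2 * a = C - m.
Hypothesis separation : a * (s + a) + m * C = 1.
Hypothesis launch : 2 * (m * C) = a * b ^ 2.
Hypothesis resonance : quarter s a = INR j * quarter C m.

Variables th ph : R -> R.
Hypothesis th_inv : inverse_pair (phase_time s a) th.
Hypothesis ph_inv : inverse_pair (phase_time C m) ph.

Definition reg_u (z : R) : R := sqrt a * cos (th z).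
Definition reg_u1 (z : R) : R := - sqrt a * sin (th z) * phase_speed s a (th z).
Definition reg_v (z : R) : R := sqrt m * sin (ph z).
Definition reg_v1 (z : R) : R := sqrt m * cos (ph z) * phase_speed C m (ph z).
Definition reg_r (z : R) : R := reg_u z ^ 2 + reg_v z ^ 2.

Let a_nonneg : 0 <= a := Rlt_le _ _ a_pos.
Let m_nonneg : 0 <= m := Rlt_le _ _ m_pos.

Lemma sqrt_sqr_a : sqrt a * sqrt a = a.
Proof. now apply sqrt_sqrt. Qed.

Lemma sqrt_sqr_m : sqrt m * sqrt m = m.
Proof. now apply sqrt_sqrt. Qed.

Lemma reg_u_sqr (z : R) : reg_u z ^ 2 = a * cos (th z) ^ 2.
Proof. unfold reg_u. rewrite Rpow_mult_distr, pow2_sqrt; trivial. Qed.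

Lemma reg_v_sqr (z : R) : reg_v z ^ 2 = m * sin (ph z) ^ 2.
Proof. unfold reg_v. rewrite Rpow_mult_distr, pow2_sqrt; trivial. Qed.

Lemma is_derive_reg_u (z : R) : is_derive reg_u z (reg_u1 z).
Proof. apply (is_derive_cos_phase s a); trivial. Qed.

Lemma is_derive_reg_v (z : R) : is_derive reg_v z (reg_v1 z).
Proof. apply (is_derive_sin_phase C m); trivial. Qed.

Lemma is_derive_reg_u1 (z : R) :
  is_derive reg_u1 z (- ((C - m) / 2) * reg_u z + reg_u z ^ 3).
Proof.
  eapply is_derive_eq.
  - apply (is_derive_cos_phase s a (sqrt a) th z); trivial.
  - replace (reg_u z ^ 3) with (reg_u z * reg_u z ^ 2) by ring. rewrite reg_u_sqr.
    assert (H := sin2_cos2 (th z)). unfold Rsqr in H.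
    replace (sin (th z) ^ 2) with (1 - cos (th z) ^ 2) by (simpl; lra).
    rewrite <- same_energy. unfold reg_u. field.
Qed.

Lemma is_derive_reg_v1 (z : R) :
  is_derive reg_v1 z (- ((C - m) / 2) * reg_v z - reg_v z ^ 3).
Proof.
  eapply is_derive_eq.
  - apply (is_derive_sin_phase C m (sqrt m) ph z); trivial.
  - replace (reg_v z ^ 3) with (reg_v z * reg_v z ^ 2) by ring. rewrite reg_v_sqr.
    unfold reg_v. field.
Qed.

(** This is the sum of the first integrals of the two oscillators; [separation] supplies the
    constant 1. *)
Lemma regularised_energy (z : R) :
  2 * (reg_u1 z ^ 2 + reg_v1 z ^ 2) = 1 + reg_u z ^ 4 - reg_v z ^ 4 - (C - m) * reg_r z.
Proof.
  unfold reg_r.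
  replace (reg_u z ^ 4) with ((reg_u z ^ 2) ^ 2) by ring.
  replace (reg_v z ^ 4) with ((reg_v z ^ 2) ^ 2) by ring.
  rewrite reg_u_sqr, reg_v_sqr, <- separation. unfold reg_u1, reg_v1.
  replace ((- sqrt a * sin (th z) * phase_speed s a (th z)) ^ 2)
    with (sqrt a * sqrt a * sin (th z) ^ 2 *
          (phase_speed s a (th z) * phase_speed s a (th z))) by ring.
  replace ((sqrt m * cos (ph z) * phase_speed C m (ph z)) ^ 2)
    with (sqrt m * sqrt m * cos (ph z) ^ 2 *
          (phase_speed C m (ph z) * phase_speed C m (ph z))) by ring.
  rewrite sqrt_sqr_a, sqrt_sqr_m, !phase_speed_sqr by trivial.
  assert (H1 := sin2_cos2 (th z)). assert (H2 := sin2_cos2 (ph z)).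
  unfold Rsqr in *.
  replace (sin (th z) ^ 2) with (1 - cos (th z) ^ 2) by (simpl; lra).
  replace (cos (ph z) ^ 2) with (1 - sin (ph z) ^ 2) by (simpl; lra).
  replace s with (C - m - 2 * a) by lra. field.
Qed.

(** With [ph_at], this locates the zeros of u at odd multiples of its quarter and those of v at even
    multiples of its own, so that common zeros are decided by parity. *)
Lemma th_at (n : Z) (z : R) :
  z = IZR (2 * n + 1) * quarter s a <-> th z = IZR n * PI + PI / 2.
Proof.
  destruct th_inv as [Hl Hr].
  assert (E : phase_time s a (IZR n * PI + PI / 2) = IZR (2 * n + 1) * quarter s a).
  { rewrite Rplus_comm, phase_time_shift_Z, plus_IZR, mult_IZR by trivial.
    unfold quarter. ring. }
  split; intros H.
  - now rewrite H, <- E, Hl.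
  - now rewrite <- E, <- H, Hr.
Qed.

Lemma ph_at (n : Z) (z : R) : z = IZR (2 * n) * quarter C m <-> ph z = IZR n * PI.
Proof.
  destruct ph_inv as [Hl Hr].
  assert (E : phase_time C m (IZR n * PI) = IZR (2 * n) * quarter C m).
  { rewrite <- (Rplus_0_l (IZR n * PI)), phase_time_shift_Z, phase_time_0, mult_IZR
      by trivial. ring. }
  split; intros H.
  - now rewrite H, <- E, Hl.
  - now rewrite <- E, <- H, Hr.
Qed.

Let Q := quarter s a.

Lemma Q_pos : 0 < Q.
Proof. now apply quarter_pos. Qed.

Lemma th_incr (x y : R) : x < y -> th x < th y.
Proof.
  apply (inverse_incr (phase_time s a)); trivial. now apply phase_time_incr.
Qed.

Lemma ph_incr (x y : R) : x < y -> ph x < ph y.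
Proof.
  apply (inverse_incr (phase_time C m)); trivial. now apply phase_time_incr.
Qed.

Lemma th_0 : th 0 = 0.
Proof. destruct th_inv as [Hl _]. generalize (Hl 0). now rewrite phase_time_0. Qed.

Lemma ph_0 : ph 0 = 0.
Proof. destruct ph_inv as [Hl _]. generalize (Hl 0). now rewrite phase_time_0. Qed.

Lemma th_Q : th Q = PI / 2.
Proof. destruct th_inv as [Hl _]. apply Hl. Qed.

Lemma th_opp_Q : th (- Q) = - (PI / 2).
Proof.
  destruct th_inv as [Hl _]. unfold Q, quarter.
  now rewrite <- phase_time_odd, Hl.
Qed.

Lemma ph_Q : ph Q = INR j * (PI / 2).
Proof.
  destruct ph_inv as [Hl _]. unfold Q.
  now rewrite resonance, <- phase_time_half_pi, Hl.
Qed.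

Lemma reg_u_pos (z : R) : - Q < z < Q -> 0 < reg_u z.
Proof.
  intros Hz. apply Rmult_lt_0_compat; [now apply sqrt_lt_R0|].
  apply cos_gt_0.
  - rewrite <- th_opp_Q. now apply th_incr.
  - rewrite <- th_Q. now apply th_incr.
Qed.

Lemma reg_u_Q : reg_u Q = 0.
Proof. unfold reg_u. rewrite th_Q, cos_PI2. ring. Qed.

Lemma reg_u_periodic (z : R) : reg_u (z + 4 * Q) = reg_u z.
Proof.
  unfold reg_u.
  replace (th (z + 4 * Q)) with (th z + IZR 1 * (2 * PI)); [now rewrite cos_shift_Z|].
  symmetry. apply (inverse_shift (phase_time s a)); trivial. intros x.
  replace (x + IZR 1 * (2 * PI)) with (x + PI + PI) by ring.
  rewrite !phase_time_shift by trivial. unfold Q. ring.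
Qed.

(** By [resonance], one period of u lasts exactly [j] periods of v. *)
Lemma reg_v_periodic (z : R) : reg_v (z + 4 * Q) = reg_v z.
Proof.
  unfold reg_v.
  replace (ph (z + 4 * Q)) with (ph z + IZR (Z.of_nat j) * (2 * PI));
    [now rewrite sin_shift_Z|].
  symmetry. apply (inverse_shift (phase_time C m)); trivial. intros x.
  rewrite <- INR_IZR_INZ.
  replace (x + INR j * (2 * PI)) with (x + INR j * PI + INR j * PI) by ring.
  rewrite !phase_time_shift_nat by trivial. unfold Q. rewrite resonance. ring.
Qed.

Lemma reg_r_periodic (z : R) : reg_r (z + 4 * Q) = reg_r z.
Proof. unfold reg_r. now rewrite reg_u_periodic, reg_v_periodic. Qed.

Lemma reg_r_nonneg (z : R) : 0 <= reg_r z.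
Proof. unfold reg_r. nra. Qed.

Lemma reg_r_pos_u (z : R) : reg_u z <> 0 -> 0 < reg_r z.
Proof. intros H. unfold reg_r. assert (0 < reg_u z ^ 2) by now apply pow2_gt_0. nra. Qed.

Lemma reg_r_continuity (z : R) : continuity_pt reg_r z.
Proof.
  apply is_derive_continuity_pt with (2 * reg_u z * reg_u1 z + 2 * reg_v z * reg_v1 z).
  assert (Hu := is_derive_reg_u z). assert (Hv := is_derive_reg_v z).
  assert (Eu := is_derive_unique _ _ _ Hu). assert (Ev := is_derive_unique _ _ _ Hv).
  unfold reg_r. auto_derive.
  - repeat split; eexists; eassumption.
  - change (Derive (fun x => reg_u x) z) with (Derive reg_u z).
    change (Derive (fun x => reg_v x) z) with (Derive reg_v z).
    rewrite Eu, Ev. ring.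
Qed.

(** Physical time as a function of regularised time. *)
Definition clock : R -> R := RInt reg_r 0.

Lemma is_derive_clock (z : R) : is_derive clock z (reg_r z).
Proof.
  apply RInt_is_derive. intros x. apply continuity_pt_filterlim, reg_r_continuity.
Qed.

Lemma clock_0 : clock 0 = 0.
Proof. apply RInt_self. Qed.

(** Since [reg_r] vanishes at collisions, the sign of the derivative gives only weak growth.
    Strictness holds because u and its derivative never vanish together. *)
Lemma clock_incr (x y : R) : x < y -> clock x < clock y.
Proof.
  assert (Hle : forall x y, x <= y -> clock x <= clock y).
  { intros x' y' H. apply derive_nonneg_le with reg_r; trivial; intros z _.
    - apply is_derive_clock.
    - apply reg_r_nonneg. }
  intros Hxy. destruct (Rle_lt_or_eq_dec _ _ (Hle x y (Rlt_le _ _ Hxy))) as [H|H];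
    trivial. exfalso.
  (* otherwise reg_r, hence reg_u and its derivative, would vanish between x and y *)
  assert (Hu : forall z, x < z < y -> reg_u z = 0).
  { intros z Hz. destruct (Req_dec (reg_u z) 0) as [E|E]; trivial. exfalso.
    apply reg_r_pos_u in E.
    assert (Hd : is_derive clock z 0).
    { apply is_derive_ext_loc with (fun _ => clock x); [|apply (is_derive_const (clock x) z)].
      assert (Hr : 0 < Rmin (z - x) (y - z)) by (apply Rmin_pos; lra).
      exists (mkposreal _ Hr). intros w Hw.
      apply Rabs_def2 in Hw. unfold minus, plus, opp in Hw. simpl in Hw.
      assert (B1 := Rmin_l (z - x) (y - z)). assert (B2 := Rmin_r (z - x) (y - z)).
      apply Rle_antisym; [apply Hle; lra | rewrite H; apply Hle; lra]. }
    apply is_derive_unique in Hd. rewrite (is_derive_unique _ _ _ (is_derive_clock z)) in Hd.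
    lra. }
  set (z := (x + y) / 2).
  assert (Hd : is_derive reg_u z 0).
  { apply is_derive_ext_loc with (fun _ => 0); [|apply (is_derive_const 0 z)].
    assert (Hr : 0 < (y - x) / 2) by lra.
    exists (mkposreal _ Hr). intros w Hw.
    apply Rabs_def2 in Hw. unfold minus, plus, opp in Hw. simpl in Hw.
    symmetry. apply Hu. unfold z in *. lra. }
  apply is_derive_unique in Hd. rewrite (is_derive_unique _ _ _ (is_derive_reg_u z)) in Hd.
  assert (Hc : reg_u z = 0) by (apply Hu; unfold z; lra).
  assert (Ha : 0 < sqrt a) by now apply sqrt_lt_R0.
  assert (Hp := phase_speed_pos s a (th z) s_pos a_nonneg).
  unfold reg_u in Hc. unfold reg_u1 in Hd.
  assert (Hs : sin (th z) = 0).
  { apply Rmult_integral in Hd. destruct Hd as [Hd|Hd]; [|lra].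
    apply Rmult_integral in Hd. destruct Hd; lra. }
  apply Rmult_integral in Hc. destruct Hc as [Hc|Hc]; [lra|].
  generalize (sin2_cos2 (th z)). rewrite Hs, Hc. unfold Rsqr. lra.
Qed.

Lemma clock_shift (z : R) : clock (z + 4 * Q) = clock z + clock (4 * Q).
Proof.
  set (f := fun z => clock (z + 4 * Q) - clock z).
  assert (Hf : forall z, is_derive f z 0).
  { intros x. apply is_derive_eq with (1 * reg_r (x + 4 * Q) - reg_r x).
    - apply (is_derive_minus (fun x => clock (x + 4 * Q)) clock).
      + apply (is_derive_comp clock (fun x => x + 4 * Q)).
        * apply is_derive_clock.
        * auto_derive; trivial.
      + apply is_derive_clock.
    - rewrite reg_r_periodic. ring. }
  assert (H := derive_zero_const f z 0 Hf). unfold f in H.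
  rewrite clock_0, Rplus_0_l in H. lra.
Qed.

Lemma clock_4Q_pos : 0 < clock (4 * Q).
Proof. rewrite <- clock_0. apply clock_incr. generalize Q_pos. lra. Qed.

Lemma clock_inverse : exists tau, inverse_pair clock tau.
Proof.
  apply incr_shift_inverse with (4 * Q) (clock (4 * Q)).
  - apply clock_incr.
  - intros x. eapply is_derive_continuity_pt, is_derive_clock.
  - apply clock_4Q_pos.
  - apply clock_shift.
Qed.

Variable tau : R -> R.
Hypothesis tau_inv : inverse_pair clock tau.

Definition orbit_x (t : R) : R := reg_u (tau t) ^ 2 - reg_v (tau t) ^ 2.
Definition orbit_y (t : R) : R := 2 * reg_u (tau t) * reg_v (tau t).
Definition orbit_vx (t : R) : R :=
  2 * (reg_u (tau t) * reg_u1 (tau t) - reg_v (tau t) * reg_v1 (tau t)) / reg_r (tau t).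
Definition orbit_vy (t : R) : R :=
  2 * (reg_u1 (tau t) * reg_v (tau t) + reg_u (tau t) * reg_v1 (tau t)) / reg_r (tau t).

Lemma tau_incr (x y : R) : x < y -> tau x < tau y.
Proof. apply (inverse_incr clock); trivial. apply clock_incr. Qed.

Lemma tau_0 : tau 0 = 0.
Proof. destruct tau_inv as [Hl _]. generalize (Hl 0). now rewrite clock_0. Qed.

(** This covers collision times too, where [reg_r] is zero and [inverse_derive] does not apply. *)
Lemma tau_continuity (t : R) : continuity_pt tau t.
Proof. apply (inverse_continuous clock); trivial. apply clock_incr. Qed.

Lemma orbit_rad (t : R) : rad (orbit_x t) (orbit_y t) = reg_r (tau t).
Proof. apply rad_levi_civita. Qed.

(** [D] will be the whole line for a periodic orbit, and the open interval between [clock (- Q)] and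
    [clock Q] for a collision orbit. *)
Lemma orbit_solution (D : R -> Prop) :
  (forall t, D t -> 0 < reg_r (tau t)) ->
  stark_solution D orbit_x orbit_y orbit_vx orbit_vy.
Proof.
  intros HD t Ht. assert (Hr := HD t Ht). rewrite orbit_rad. split; trivial.
  apply (levi_civita reg_u reg_u1 reg_v reg_v1 tau (C - m) t); trivial.
  - apply (inverse_derive clock); trivial.
    + apply clock_incr.
    + apply is_derive_clock.
    + apply Rgt_not_eq, Hr.
  - apply is_derive_reg_u.
  - apply is_derive_reg_u1.
  - apply is_derive_reg_v.
  - apply is_derive_reg_v1.
  - apply regularised_energy.
Qed.

Lemma orbit_init : init_cond a b orbit_x orbit_y orbit_vx orbit_vy.
Proof.
  unfold init_cond, orbit_x, orbit_y, orbit_vx, orbit_vy, reg_r.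
  rewrite tau_0, reg_u_sqr, reg_v_sqr. unfold reg_u, reg_v, reg_u1, reg_v1.
  rewrite th_0, ph_0, sin_0, cos_0.
  assert (Ha : 0 < sqrt a) by now apply sqrt_lt_R0.
  repeat split; try ring.
  - field. lra.
  (* The left side is v'(0). Both sides are nonnegative, so it suffices to compare squares, and that
     is [launch]. *)
  - assert (E : sqrt m * phase_speed C m 0 = sqrt a * b / 2).
    { apply Rsqr_inj.
      - apply Rmult_le_pos; [apply sqrt_pos | apply Rlt_le, phase_speed_pos; trivial].
      - nra.
      - unfold Rsqr.
        transitivity (sqrt m * sqrt m * (phase_speed C m 0 * phase_speed C m 0)); [ring|].
        transitivity (sqrt a * sqrt a * b ^ 2 / 4); [|field].
        rewrite sqrt_sqr_m, sqrt_sqr_a, phase_speed_sqr, sin_0 by trivial.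
        replace (a * b ^ 2) with (2 * (m * C)) by lra. field. }
    transitivity (2 * sqrt a * (sqrt m * phase_speed C m 0) / a); [field; lra|].
    rewrite E. transitivity (sqrt a * sqrt a * b / a); [field; lra|].
    rewrite sqrt_sqr_a. field. lra.
Qed.

Lemma orbit_periodic (t : R) :
  orbit_x (t + clock (4 * Q)) = orbit_x t /\ orbit_y (t + clock (4 * Q)) = orbit_y t.
Proof.
  unfold orbit_x, orbit_y.
  rewrite (inverse_shift clock tau (4 * Q)) by (trivial; apply clock_shift).
  now rewrite reg_u_periodic, reg_v_periodic.
Qed.

Lemma tau_range (t : R) : 0 < t < clock Q -> 0 < tau t < Q.
Proof.
  intros Ht. destruct tau_inv as [Hl _]. split.
  - rewrite <- tau_0. now apply tau_incr.
  - rewrite <- (Hl Q). now apply tau_incr.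
Qed.

(** Before regularised time [Q], u is positive, so crossings are the zeros of v. There [ph] runs
    from 0 to [j] quarter turns and meets n PI exactly for 0 < 2n < j, that is n = 1, ..., k for
    either value of [j]. *)
Lemma orbit_crossings (k : nat) : (j = 2 * k + 1 \/ j = 2 * k + 2)%nat ->
  exactly_k_times (fun t => 0 < t < clock Q /\ orbit_y t = 0 /\ 0 < orbit_x t) k.
Proof.
  intros Hj. destruct ph_inv as [phl phr]. destruct tau_inv as [taul taur].
  assert (HPI := PI_RGT_0).
  (* The successor skips the launch point, where [ph] is 0. *)
  set (ts := fun i => clock (phase_time C m (INR (S i) * PI))).
  assert (Hts : forall i, tau (ts i) = phase_time C m (INR (S i) * PI))
    by (intros; apply taul).
  exists ts. split.
  - intros i l Hil. apply clock_incr, phase_time_incr; trivial.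
    apply Rmult_lt_compat_r; trivial. apply lt_INR. lia.
  - intros t. split.
    + intros [Ht [Hy Hx]]. assert (Hz := tau_range t Ht).
      assert (Hu : 0 < reg_u (tau t)) by (apply reg_u_pos; lra).
      assert (Hv : sin (ph (tau t)) = 0).
      { unfold orbit_y, reg_v in Hy. assert (0 < sqrt m) by now apply sqrt_lt_R0.
        apply Rmult_integral in Hy. destruct Hy as [Hy|Hy]; [lra|].
        apply Rmult_integral in Hy. lra. }
      apply sin_eq_0_0 in Hv. destruct Hv as [n Hn].
      assert (H0 : 0 < ph (tau t)) by (rewrite <- ph_0; now apply ph_incr).
      assert (H1 : ph (tau t) < INR j * (PI / 2))
        by (rewrite <- ph_Q; now apply ph_incr).
      assert (Hn0 : (0 < n)%Z) by (apply lt_IZR; nra).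
      assert (Hn1 : (2 * n < Z.of_nat j)%Z).
      { apply lt_IZR. rewrite mult_IZR, <- INR_IZR_INZ. nra. }
      exists (Z.to_nat (n - 1)). split; [lia|].
      unfold ts. replace (INR (S (Z.to_nat (n - 1)))) with (IZR n)
        by (rewrite INR_IZR_INZ; f_equal; lia).
      rewrite <- Hn, phr, taur. trivial.
    + intros [i [Hi ->]].
      assert (Hz : 0 < tau (ts i) < Q).
      { rewrite Hts. split.
        - rewrite <- (phase_time_0 C m). apply phase_time_incr; trivial.
          apply Rmult_lt_0_compat; trivial. apply lt_0_INR. lia.
        - unfold Q. rewrite resonance, <- phase_time_half_pi by trivial.
          apply phase_time_incr; trivial.
          apply Rlt_le_trans with (INR (2 * (S i)) * (PI / 2) + PI / 2).
          + rewrite mult_INR. simpl (INR 2). lra.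
          + replace (INR (2 * S i) * (PI / 2) + PI / 2)
              with (INR (2 * S i + 1) * (PI / 2))
              by (rewrite plus_INR; simpl (INR 1); ring).
            apply Rmult_le_compat_r; [lra|]. apply le_INR. lia. }
      assert (Hu : 0 < reg_u (tau (ts i))) by (apply reg_u_pos; lra).
      assert (Hv : reg_v (tau (ts i)) = 0).
      { unfold reg_v. rewrite Hts, phl.
        rewrite (sin_eq_0_1 (INR (S i) * PI)); [ring|].
        exists (Z.of_nat (S i)). now rewrite INR_IZR_INZ. }
      split; [|split].
      * rewrite <- (taur (ts i)). split.
        -- rewrite <- clock_0 at 1. now apply clock_incr.
        -- now apply clock_incr.
      * unfold orbit_y. rewrite Hv. ring.
      * unfold orbit_x. rewrite Hv. nra.
Qed.

(** At [Q], u vanishes and [ph] equals (k + 1) PI, so v vanishes too. Since u is positive on the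
    symmetric interval around 0, the solution also extends to negative times. *)
Lemma resonant_collision (k : nat) : (j = 2 * k + 2)%nat -> collision_orbit_k a b k.
Proof.
  intros Hj. destruct tau_inv as [taul taur]. assert (HQ := Q_pos).
  exists orbit_x, orbit_y, orbit_vx, orbit_vy, (clock (- Q)), (clock Q).
  split; [|split; [|split; [|split]]].
  - generalize (clock_incr (- Q) 0) (clock_incr 0 Q). rewrite clock_0. lra.
  - apply orbit_solution. intros t Ht. apply reg_r_pos_u, Rgt_not_eq, reg_u_pos.
    destruct Ht as [H1 H2]. apply tau_incr in H1, H2. rewrite taul in H1, H2. lra.
  - apply orbit_init.
  - apply filterlim_ext with (fun t => reg_r (tau t)).
    + intros t. now rewrite orbit_rad.
    + assert (E : reg_r (tau (clock Q)) = 0).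
      { rewrite taul. unfold reg_r. rewrite reg_u_Q.
        replace (reg_v Q) with 0; [ring|]. unfold reg_v. rewrite ph_Q.
        rewrite (sin_eq_0_1 (INR j * (PI / 2))); [ring|].
        exists (Z.of_nat (k + 1)). rewrite <- INR_IZR_INZ, Hj.
        rewrite !plus_INR, mult_INR. simpl. field. }
      rewrite <- E. eapply filterlim_filter_le_1.
      * apply filter_le_within.
      * apply (continuity_pt_filterlim (fun t => reg_r (tau t))).
        apply (continuity_pt_comp tau reg_r); [apply tau_continuity | apply reg_r_continuity].
  - apply orbit_crossings. now right.
Qed.

(** Zeros of u are odd multiples of [j] quarters of v. For odd [j] these are odd multiples of that
    quarter, whereas v vanishes only at even ones. *)
Lemma reg_r_pos_odd (k : nat) (z : R) : (j = 2 * k + 1)%nat -> 0 < reg_r z.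
Proof.
  intros Hj. destruct (Req_dec (reg_u z) 0) as [Hu|Hu]; [|now apply reg_r_pos_u].
  assert (Ha : 0 < sqrt a) by now apply sqrt_lt_R0.
  assert (Hm : 0 < sqrt m) by now apply sqrt_lt_R0.
  unfold reg_u in Hu. apply Rmult_integral in Hu. destruct Hu as [Hu|Hu]; [lra|].
  apply cos_eq_0_0 in Hu. destruct Hu as [n Hn]. apply th_at in Hn.
  assert (Hv : sin (ph z) <> 0).
  { intros Hv. apply sin_eq_0_0 in Hv. destruct Hv as [l Hl]. apply ph_at in Hl.
    rewrite resonance in Hn.
    assert (Hq := quarter_pos C m C_pos m_nonneg).
    assert (E : IZR ((2 * n + 1) * Z.of_nat j) = IZR (2 * l)).
    { rewrite (mult_IZR (2 * n + 1)), <- INR_IZR_INZ. nra. }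
    apply eq_IZR in E. lia. }
  unfold reg_r. rewrite (reg_v_sqr z).
  assert (0 < sin (ph z) ^ 2) by now apply pow2_gt_0. nra.
Qed.

(** At [Q], u vanishes while [ph] is an odd multiple of PI/2, so v is extremal. Hence x = -v^2 is
    negative, and the velocity is vertical and proportional to u' v, which is nonzero. *)
Lemma resonant_periodic (k : nat) : (j = 2 * k + 1)%nat -> periodic_orbit_k a b k.
Proof.
  intros Hj. destruct tau_inv as [taul taur]. assert (HQ := Q_pos).
  assert (Ha : 0 < sqrt a) by now apply sqrt_lt_R0.
  assert (Hm : 0 < sqrt m) by now apply sqrt_lt_R0.
  assert (Hcos : cos (ph Q) = 0).
  { rewrite ph_Q. apply cos_eq_0_1. exists (Z.of_nat k).
    rewrite <- INR_IZR_INZ, Hj, plus_INR, mult_INR. simpl. field. }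
  assert (Hsin : sin (ph Q) <> 0).
  { intros H. generalize (sin2_cos2 (ph Q)). rewrite H, Hcos. unfold Rsqr. lra. }
  assert (Hv : reg_v Q <> 0) by (apply Rmult_integral_contrapositive; lra).
  exists orbit_x, orbit_y, orbit_vx, orbit_vy. split; [|split; [|split]].
  - apply orbit_solution. intros t _. now apply reg_r_pos_odd with k.
  - apply orbit_init.
  - exists (clock (4 * Q)). split; [apply clock_4Q_pos | apply orbit_periodic].
  - exists (clock Q). split; [|split; [|split]].
    + rewrite <- clock_0. now apply clock_incr.
    + apply orbit_crossings. now left.
    + intros t Ht [Hy Hx]. assert (Hz := tau_range t Ht).
      assert (Hu : 0 < reg_u (tau t)) by (apply reg_u_pos; lra).
      unfold orbit_y in Hy. apply Rmult_integral in Hy. destruct Hy as [Hy|Hy]; [lra|].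
      unfold orbit_x in Hx. rewrite Hy in Hx. nra.
    + unfold orbit_x, orbit_y, orbit_vx, orbit_vy. rewrite taul, reg_u_Q.
      assert (Hr : 0 < reg_r Q) by now apply reg_r_pos_odd with k.
      assert (Hv1 : reg_v1 Q = 0) by (unfold reg_v1; rewrite Hcos; ring).
      assert (Hv2 : 0 < reg_v Q ^ 2) by now apply pow2_gt_0.
      assert (Hu1 : reg_u1 Q < 0).
      { unfold reg_u1. rewrite th_Q, sin_PI2.
        assert (Hp := phase_speed_pos s a (PI / 2) s_pos a_nonneg). nra. }
      rewrite Hv1. repeat split.
      * ring.
      * nra.
      * field. lra.
      * apply Rmult_integral_contrapositive. split.
        -- rewrite Rmult_0_l, Rplus_0_r. intros H.
           apply Rmult_integral in H. destruct H as [H|H]; [lra|].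
           apply Rmult_integral in H. lra.
        -- apply Rgt_not_eq, Rinv_0_lt_compat, Hr.
Qed.

End ResonantOrbit.

(** * Continuity and bounds for the quarter periods *)

(** By the mean value theorem the difference is PI/2 times 1/p - 1/p' for speeds p, p' at one angle.
    This equals (p'^2 - p^2)/(p p' (p + p')), where the squares are affine in the parameters and
    both speeds are at least [kappa]. *)
Lemma quarter_lipschitz (kappa s m s' m' : R) :
  0 < kappa -> 2 * kappa ^ 2 <= s -> 2 * kappa ^ 2 <= s' -> 0 <= m -> 0 <= m' ->
  Rabs (quarter s m - quarter s' m')
    <= PI / (8 * kappa ^ 3) * (Rabs (s - s') + Rabs (m - m')).
Proof.
  intros Hk Hs Hs' Hm Hm'. assert (HPI := PI_RGT_0).
  assert (s_pos : 0 < s) by nra. assert (s'_pos : 0 < s') by nra.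
  destruct (mean_value (fun x => phase_time s m x - phase_time s' m' x)
    (fun x => / phase_speed s m x - / phase_speed s' m' x) 0 (PI / 2)) as [x [_ E]].
  { lra. }
  { intros x _. apply (is_derive_minus (phase_time s m) (phase_time s' m'));
      now apply is_derive_phase_time. }
  rewrite !phase_time_0 in E. fold (quarter s m) (quarter s' m') in E.
  replace (quarter s m - quarter s' m') with
    ((/ phase_speed s m x - / phase_speed s' m' x) * (PI / 2)) by lra.
  assert (Hsin := sin_sqr_bounds x).
  assert (P := phase_speed_pos s m x s_pos Hm).
  assert (P' := phase_speed_pos s' m' x s'_pos Hm').
  assert (S := phase_speed_sqr s m x s_pos Hm).
  assert (S' := phase_speed_sqr s' m' x s'_pos Hm').
  set (p := phase_speed s m x) in *. set (p' := phase_speed s' m' x) in *.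
  assert (Hp : kappa <= p) by nra. assert (Hp' : kappa <= p') by nra.
  replace ((/ p - / p') * (PI / 2)) with
    ((s' - s + (m' - m) * sin x ^ 2) * (PI / 4 * / (p * p' * (p + p')))).
  2: { replace (s' - s + (m' - m) * sin x ^ 2) with (2 * (p' * p' - p * p)) by lra.
       field. lra. }
  assert (Hd : 2 * kappa ^ 3 <= p * p' * (p + p')).
  { replace (2 * kappa ^ 3) with (kappa * kappa * (kappa + kappa)) by ring.
    assert (kappa * kappa <= p * p') by (apply Rmult_le_compat; lra).
    apply Rmult_le_compat; nra. }
  assert (Hk3 : 0 < kappa ^ 3) by now apply pow_lt.
  rewrite Rabs_mult, (Rabs_pos_eq (PI / 4 * _)).
  2: { apply Rmult_le_pos; [lra|]. apply Rlt_le, Rinv_0_lt_compat. lra. }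
  rewrite Rmult_comm. apply Rmult_le_compat.
  - apply Rmult_le_pos; [lra|]. apply Rlt_le, Rinv_0_lt_compat. lra.
  - apply Rabs_pos.
  - replace (PI / (8 * kappa ^ 3)) with (PI / 4 * / (2 * kappa ^ 3)) by (field; lra).
    apply Rmult_le_compat_l; [lra|]. apply Rinv_le_contravar; lra.
  - eapply Rle_trans; [apply Rabs_triang|].
    rewrite (Rabs_minus_sym s s'), (Rabs_minus_sym m m'), Rabs_mult,
      (Rabs_pos_eq (sin x ^ 2)) by lra.
    generalize (Rabs_pos (m' - m)). nra.
Qed.

Lemma quarter_continuity (S M : R -> R) (x0 : R) :
  continuity_pt S x0 -> continuity_pt M x0 -> 0 < S x0 -> (forall x, 0 <= M x) ->
  continuity_pt (fun x => quarter (S x) (M x)) x0.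
Proof.
  intros HS HM Hpos HM0. apply continuity_pt_locally. intros eps.
  (* With this choice [2 * kappa ^ 2] is half of [S x0], a lower bound for [S] near [x0]. *)
  set (kappa := sqrt (S x0) / 2).
  assert (Hk : 0 < kappa) by (generalize (sqrt_lt_R0 _ Hpos); unfold kappa; lra).
  assert (Hk2 : 4 * kappa ^ 2 = S x0).
  { replace (4 * kappa ^ 2) with (sqrt (S x0) * sqrt (S x0)) by (unfold kappa; field).
    apply sqrt_sqrt. lra. }
  assert (HK : 0 < PI / (8 * kappa ^ 3)).
  { apply Rdiv_lt_0_compat; [apply PI_RGT_0|]. assert (0 < kappa ^ 3) by now apply pow_lt.
    lra. }
  set (K := PI / (8 * kappa ^ 3)) in *.
  assert (He : 0 < eps / (2 * K)) by (apply Rdiv_lt_0_compat; [apply cond_pos | lra]).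
  assert (Hm : 0 < Rmin (eps / (2 * K)) (S x0 / 2)) by (apply Rmin_pos; lra).
  apply continuity_pt_locally with (eps := mkposreal _ Hm) in HS.
  apply continuity_pt_locally with (eps := mkposreal _ He) in HM.
  generalize (filter_and _ _ HS HM). apply filter_imp. intros x [H1 H2].
  simpl in H1, H2.
  assert (B1 := Rmin_l (eps / (2 * K)) (S x0 / 2)).
  assert (B2 := Rmin_r (eps / (2 * K)) (S x0 / 2)).
  eapply Rle_lt_trans; [apply (quarter_lipschitz kappa); trivial|].
  - apply Rlt_le_trans with (2 := B2) in H1. apply Rabs_def2 in H1. lra.
  - lra.
  - fold K. replace (pos eps) with (K * (eps / (2 * K) + eps / (2 * K))) by (field; lra).
    apply Rmult_lt_compat_l; lra.
Qed.

Lemma quarter_upper (s m q : R) : 0 < q -> 2 * q ^ 2 <= s -> 0 <= m ->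
  quarter s m <= PI / 2 / q.
Proof.
  intros Hq Hs Hm. assert (s_pos : 0 < s) by nra. assert (HPI := PI_RGT_0).
  destruct (mean_value (phase_time s m) (fun x => / phase_speed s m x) 0 (PI / 2))
    as [x [_ E]]; [lra | intros; now apply is_derive_phase_time |].
  rewrite phase_time_0 in E. unfold quarter.
  replace (phase_time s m (PI / 2)) with (PI / 2 * / phase_speed s m x) by lra.
  apply Rmult_le_compat_l; [lra|]. apply Rinv_le_contravar; trivial.
  assert (P := phase_speed_pos s m x s_pos Hm).
  assert (S := phase_speed_sqr s m x s_pos Hm).
  assert (Hsin := sin_sqr_bounds x). nra.
Qed.

(** Because sin x <= x, the speed is at most sqrt s + x, whose reciprocal integrates to a logarithm;
    the upper endpoint contributes a nonnegative amount as PI/2 > 1. This is the logarithmic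
    slowdown near the saddle. *)
Lemma quarter_lower (s m : R) : 0 < s -> 0 <= m <= 1 -> - ln (sqrt s) <= quarter s m.
Proof.
  intros Hs Hm. assert (HPI := PI_RGT_0). assert (HPI2 := PI2_1).
  assert (Hq : 0 < sqrt s) by now apply sqrt_lt_R0.
  assert (Hqq : sqrt s * sqrt s = s) by (apply sqrt_sqrt; lra).
  assert (H : phase_time s m 0 - ln (sqrt s + 0)
              <= phase_time s m (PI / 2) - ln (sqrt s + PI / 2)).
  { apply derive_nonneg_le with
      (f := fun x => phase_time s m x - ln (sqrt s + x))
      (df := fun x => / phase_speed s m x - / (sqrt s + x)); [lra| |].
    - intros x Hx.
      apply (is_derive_minus (phase_time s m) (fun x => ln (sqrt s + x))).
      + now apply is_derive_phase_time.
      + auto_derive; [lra | field; lra].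
    - intros x Hx. assert (P := phase_speed_pos s m x Hs (proj1 Hm)).
      assert (S := phase_speed_sqr s m x Hs (proj1 Hm)).
      assert (Hsin := sin_sqr_bounds x).
      assert (Hsx : sin x ^ 2 <= x ^ 2).
      { assert (0 <= sin x) by (apply sin_ge_0; lra).
        assert (sin x <= x) by (destruct (Req_dec x 0) as [->|];
          [rewrite sin_0; lra | apply Rlt_le, sin_lt_x; lra]). nra. }
      assert (phase_speed s m x <= sqrt s + x) by nra.
      assert (/ (sqrt s + x) <= / phase_speed s m x); [|lra].
      apply Rinv_le_contravar; lra. }
  rewrite phase_time_0, Rplus_0_r in H.
  assert (0 <= ln (sqrt s + PI / 2)).
  { rewrite <- ln_1. apply ln_le; lra. }
  unfold quarter. lra.
Qed.

(** * The winding ratio as a function of the launch velocity *)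

(* Separation constants of the orbit launched from (a, 0) with velocity (0, b), of
   energy E = - energy_gap a b: with u^2 = (r+x)/2 and v^2 = (r-x)/2 one has
   2 u'^2 = (a - u^2) (u_gap + a - u^2) and 2 v'^2 = (v_amp - v^2) (v_gap + v^2). *)
Definition energy_gap (a b : R) : R := 1 / a + a - b ^ 2 / 2.
Definition u_gap (a b : R) : R := 1 / a - a - b ^ 2 / 2.
Definition v_disc (a b : R) : R := sqrt (energy_gap a b ^ 2 + 2 * a * b ^ 2).
Definition v_gap (a b : R) : R := (v_disc a b + energy_gap a b) / 2.
Definition v_amp (a b : R) : R := (v_disc a b - energy_gap a b) / 2.
Definition winding (a b : R) : R :=
  quarter (u_gap a b) a / quarter (v_gap a b) (v_amp a b).

Lemma energy_gap_eq (a b : R) : energy_gap a b = u_gap a b + 2 * a.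
Proof. unfold energy_gap, u_gap. ring. Qed.

Lemma v_disc_sqr (a b : R) : 0 < a ->
  v_disc a b * v_disc a b = energy_gap a b ^ 2 + 2 * a * b ^ 2.
Proof.
  intros Ha. apply sqrt_sqrt. generalize (pow2_ge_0 (energy_gap a b)) (pow2_ge_0 b). nra.
Qed.

Lemma v_disc_pos (a b : R) : 0 <= v_disc a b.
Proof. apply sqrt_pos. Qed.

Lemma v_amp_nonneg (a b : R) : 0 < a -> 0 <= v_amp a b.
Proof.
  intros Ha. assert (H := v_disc_sqr a b Ha). assert (H' := v_disc_pos a b).
  assert (Hb := pow2_ge_0 b). unfold v_amp. nra.
Qed.

Lemma v_amp_pos (a b : R) : 0 < a -> 0 < b -> 0 < v_amp a b.
Proof.
  intros Ha Hb. assert (H := v_disc_sqr a b Ha). assert (H' := v_disc_pos a b).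
  assert (0 < a * b ^ 2) by (apply Rmult_lt_0_compat; [|apply pow_lt]; trivial).
  unfold v_amp. nra.
Qed.

Lemma v_gap_lower (a b : R) : 0 < a -> 0 < u_gap a b -> 2 * a < v_gap a b.
Proof.
  intros Ha Hu. assert (H := v_amp_nonneg a b Ha). assert (E := energy_gap_eq a b).
  unfold v_amp in H. unfold v_gap. lra.
Qed.

Lemma resonant_orbits (a b : R) (j k : nat) :
  0 < a -> 0 < b -> 0 < u_gap a b -> winding a b = INR j ->
  ((j = 2 * k + 1)%nat -> periodic_orbit_k a b k) /\
  ((j = 2 * k + 2)%nat -> collision_orbit_k a b k).
Proof.
  intros Ha Hb Hu Hw.
  assert (Hm := v_amp_pos a b Ha Hb). assert (HC := v_gap_lower a b Ha Hu).
  assert (HC0 : 0 < v_gap a b) by lra.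
  assert (Hd := v_disc_sqr a b Ha).
  assert (E1 : u_gap a b + 2 * a = v_gap a b - v_amp a b).
  { rewrite <- energy_gap_eq. unfold v_gap, v_amp. field. }
  assert (E2 : 2 * (v_amp a b * v_gap a b) = a * b ^ 2).
  { unfold v_amp, v_gap. lra. }
  assert (E3 : a * (u_gap a b + a) + v_amp a b * v_gap a b = 1).
  { replace (v_amp a b * v_gap a b) with (a * b ^ 2 / 2) by lra.
    unfold u_gap. field. lra. }
  assert (Hq := quarter_pos (v_gap a b) (v_amp a b) HC0 (Rlt_le _ _ Hm)).
  assert (E4 : quarter (u_gap a b) a = INR j * quarter (v_gap a b) (v_amp a b)).
  { rewrite <- Hw. unfold winding. field. lra. }
  destruct (phase_exists (u_gap a b) a) as [th Hth]; [lra|lra|].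
  destruct (phase_exists (v_gap a b) (v_amp a b)) as [ph Hph]; [lra|lra|].
  destruct (clock_inverse a (u_gap a b) (v_gap a b) (v_amp a b) j) with th ph
    as [tau Htau]; trivial.
  split; intros Hj.
  - apply (resonant_periodic a b (u_gap a b) (v_gap a b) (v_amp a b) j) with th ph tau;
      trivial.
  - apply (resonant_collision a b (u_gap a b) (v_gap a b) (v_amp a b) j) with th ph tau;
      trivial.
Qed.

Lemma winding_continuity (a b : R) : 0 < a -> 0 < u_gap a b ->
  continuity_pt (winding a) b.
Proof.
  intros Ha Hu. assert (Hm := v_amp_nonneg a b Ha).
  assert (HC := v_gap_lower a b Ha Hu).
  assert (Hg : continuity_pt (energy_gap a) b).
  { apply is_derive_continuity_pt with (- b). unfold energy_gap.
    auto_derive; trivial. field. }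
  assert (Hr : continuity_pt (v_disc a) b).
  { unfold v_disc.
    apply (continuity_pt_comp (fun b => energy_gap a b ^ 2 + 2 * a * b ^ 2) sqrt).
    - unfold energy_gap. apply is_derive_continuity_pt with
        (2 * (1 / a + a - b ^ 2 / 2) * (- b) + 4 * a * b).
      auto_derive; trivial. field. lra.
    - apply continuity_pt_sqrt.
      generalize (pow2_ge_0 (energy_gap a b)) (pow2_ge_0 b). nra. }
  apply continuity_pt_div.
  - apply (quarter_continuity (u_gap a) (fun _ => a)); trivial.
    + apply is_derive_continuity_pt with (- b). unfold u_gap.
      auto_derive; trivial. field.
    + apply continuity_pt_const. now intros x y.
    + intros; lra.
  - apply (quarter_continuity (v_gap a) (v_amp a)).
    + unfold v_gap. apply continuity_pt_mult.
      * now apply continuity_pt_plus.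
      * apply continuity_pt_const. now intros x y.
    + unfold v_amp. apply continuity_pt_mult.
      * now apply continuity_pt_minus.
      * apply continuity_pt_const. now intros x y.
    + lra.
    + intros x. now apply v_amp_nonneg.
  - assert (H := quarter_pos (v_gap a b) (v_amp a b)). lra.
Qed.

(** As b tends to [B], [u_gap a b] = (B^2 - b^2)/2 tends to 0 and the quarter of u diverges, while
    that of v stays below [K] because [v_gap] exceeds 2a. *)
Lemma winding_blowup (a B M : R) : 0 < a < 1 -> 0 < B -> B ^ 2 = 2 / a - 2 * a -> 0 <= M ->
  exists b0, b0 < B /\ forall b, 0 <= b -> b0 < b < B -> M < winding a b.
Proof.
  intros Ha HB HB2 HM. assert (HPI := PI_RGT_0).
  assert (Hsa : 0 < sqrt a) by (apply sqrt_lt_R0; lra).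
  assert (Hsa2 : sqrt a ^ 2 = a) by (apply pow2_sqrt; lra).
  set (K := PI / 2 / sqrt a). assert (HK : 0 < K) by (apply Rdiv_lt_0_compat; lra).
  (* Then -ln eta = M K + 1, so a gap below eta^2 makes the quarter of u exceed M K. The distance
     eta^2 / B from [B] ensures such a gap. *)
  set (eta := exp (- (M * K) - 1)). assert (Heta : 0 < eta) by apply exp_pos.
  exists (B - eta ^ 2 / B). split.
  { assert (0 < eta ^ 2 / B) by (apply Rdiv_lt_0_compat; [now apply pow_lt | trivial]).
    lra. }
  intros b Hb [Hb0 HbB].
  assert (Eu : u_gap a b = (B ^ 2 - b ^ 2) / 2) by (rewrite HB2; unfold u_gap; field; lra).
  assert (Hu : 0 < u_gap a b) by (rewrite Eu; nra).
  assert (Hu' : u_gap a b < eta ^ 2).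
  { assert (B * (B - b) < eta ^ 2); [|rewrite Eu; nra].
    replace (eta ^ 2) with (B * (eta ^ 2 / B)) by (field; lra).
    apply Rmult_lt_compat_l; lra. }
  assert (Hl : M * K < quarter (u_gap a b) a).
  { apply Rlt_le_trans with (- ln (sqrt (u_gap a b))); [|apply quarter_lower; lra].
    assert (ln (sqrt (u_gap a b)) <= ln eta).
    { apply ln_le; [now apply sqrt_lt_R0|].
      rewrite <- (sqrt_pow2 eta) by lra. apply sqrt_le_1_alt. lra. }
    unfold eta in H. rewrite ln_exp in H. lra. }
  assert (Hm := v_amp_nonneg a b (proj1 Ha)).
  assert (HC := v_gap_lower a b (proj1 Ha) Hu).
  assert (Hv : quarter (v_gap a b) (v_amp a b) <= K)
    by (apply quarter_upper; trivial; lra).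
  assert (Hv0 : 0 < quarter (v_gap a b) (v_amp a b)) by (apply quarter_pos; lra).
  unfold winding. apply Rmult_lt_reg_r with (quarter (v_gap a b) (v_amp a b)); trivial.
  unfold Rdiv. rewrite Rmult_assoc, Rinv_l by lra. nra.
Qed.

(** * Last crossings of integer levels and existence of the families *)

(** [L n] is the supremum of the points where [f <= n]. It stays below [B] by the blow-up, and
    continuity gives the exact level there. These sets grow with n, which orders the [L n] however
    [f] oscillates, and each point below [B] eventually belongs to them, which gives the limit. *)
Lemma last_crossings (f : R -> R) (B : R) :
  0 < B -> (forall x, 0 <= x < B -> continuity_pt f x) ->
  (forall M, 0 <= M -> exists x0, x0 < B /\ forall x, 0 <= x -> x0 < x < B -> M < f x) ->
  exists L : nat -> R,
    (forall n, f 0 < INR n -> 0 < L n < B /\ f (L n) = INR n) /\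
    (forall n k, (n < k)%nat -> f 0 < INR n -> L n < L k) /\
    (forall eps, 0 < eps -> exists N, forall n, (N <= n)%nat -> Rabs (L n - B) < eps).
Proof.
  intros HB Hc Hblow.
  set (S := fun (n : nat) x => 0 <= x < B /\ f x <= INR n).
  assert (Hex : forall n, exists l, f 0 < INR n -> is_lub (S n) l).
  { intros n. destruct (Rlt_dec (f 0) (INR n)) as [H|H].
    - destruct (completeness (S n)) as [l Hl].
      + exists B. intros x [Hx _]. lra.
      + exists 0. split; lra.
      + now exists l.
    (* An arbitrary value for the levels not above [f 0]. *)
    - exists 0. lra. }
  set (L := fun n => proj1_sig (constructive_indefinite_description _ (Hex n))).
  assert (HL : forall n, f 0 < INR n -> is_lub (S n) (L n)).
  { intros n. apply (proj2_sig (constructive_indefinite_description _ (Hex n))). }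
  assert (H1 : forall n, f 0 < INR n -> 0 < L n < B /\ f (L n) = INR n).
  { intros n Hn. destruct (HL n Hn) as [Hub Hlub].
    assert (L0 : 0 <= L n) by (apply Hub; split; lra).
    assert (LB : L n < B).
    { destruct (Hblow (INR n) (pos_INR n)) as [x0 [Hx0 Hx0']].
      apply Rle_lt_trans with (Rmax 0 x0).
      - apply Hlub. intros x [Hx Hfx].
        destruct (Rle_dec x x0); [generalize (Rmax_r 0 x0); lra|].
        specialize (Hx0' x). lra.
      - now apply Rmax_lub_lt. }
    assert (E : f (L n) = INR n).
    { assert (Hcn := Hc (L n) (conj L0 LB)).
      destruct (Rtotal_order (f (L n)) (INR n)) as [Hlt|[Heq|Hgt]]; trivial; exfalso.
      - assert (He : 0 < INR n - f (L n)) by lra.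
        destruct (proj1 (continuity_pt_locally _ _) Hcn (mkposreal _ He)) as [d Hd].
        assert (Hd0 := cond_pos d).
        set (x := L n + Rmin (d / 2) ((B - L n) / 2)).
        assert (Hm : 0 < Rmin (d / 2) ((B - L n) / 2)) by (apply Rmin_pos; lra).
        assert (B1 := Rmin_l (d / 2) ((B - L n) / 2)).
        assert (B2 := Rmin_r (d / 2) ((B - L n) / 2)).
        assert (x <= L n); [|unfold x in *; lra].
        apply Hub. split; [unfold x; lra|].
        assert (Hx : Rabs (f x - f (L n)) < INR n - f (L n)).
        { apply Hd. apply Rabs_def1; unfold minus, plus, opp, x; simpl; lra. }
        apply Rabs_def2 in Hx. lra.
      - assert (He : 0 < f (L n) - INR n) by lra.
        destruct (proj1 (continuity_pt_locally _ _) Hcn (mkposreal _ He)) as [d Hd].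
        assert (Hd0 := cond_pos d).
        assert (L n <= L n - d / 2); [|lra].
        apply Hlub. intros x Hx. assert (Hxl := Hub x Hx). destruct Hx as [_ Hfx].
        destruct (Rle_dec x (L n - d / 2)) as [H|H]; trivial. exfalso.
        assert (Hx : Rabs (f x - f (L n)) < f (L n) - INR n).
        { apply Hd. apply Rabs_def1; unfold minus, plus, opp; simpl; lra. }
        apply Rabs_def2 in Hx. lra. }
    split; trivial. split; trivial.
    destruct (Rle_lt_or_eq_dec _ _ L0) as [H|H]; trivial.
    rewrite <- H in E. lra. }
  exists L. split; [exact H1|split].
  - intros n k Hnk Hn. assert (Hnk' : INR n < INR k) by now apply lt_INR.
    destruct (H1 n Hn) as [Bn En]. destruct (H1 k) as [Bk Ek]; [lra|].
    destruct (HL k) as [Hub _]; [lra|].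
    assert (Hle : L n <= L k) by (apply Hub; split; lra).
    destruct (Rle_lt_or_eq_dec _ _ Hle) as [H|H]; trivial.
    rewrite H in En. lra.
  - intros eps He. set (x := Rmax 0 (B - eps / 2)).
    assert (Hx0 := Rmax_l 0 (B - eps / 2)). assert (Hx1 := Rmax_r 0 (B - eps / 2)).
    assert (HxB : Rmax 0 (B - eps / 2) < B) by (apply Rmax_lub_lt; lra).
    fold x in Hx0, Hx1, HxB.
    destruct (INR_unbounded (Rmax (f 0) (f x))) as [N HN].
    exists N. intros n Hn. apply le_INR in Hn.
    assert (F0 := Rmax_l (f 0) (f x)). assert (Fx := Rmax_r (f 0) (f x)).
    destruct (H1 n) as [Bn _]; [lra|]. destruct (HL n) as [Hub _]; [lra|].
    assert (x <= L n) by (apply Hub; split; lra).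
    apply Rabs_def1; lra.
Qed.

Lemma stark_families_exist (a : R) : 0 < a < 1 ->
  exists (kp : nat) (b b' : nat -> R), stark_families a kp b b'.
Proof.
  intros Ha. set (B := sqrt (2 / a - 2 * a)).
  assert (Hpos : 0 < 2 / a - 2 * a).
  { replace (2 / a - 2 * a) with (2 * (1 - a) * (1 + a) / a) by (field; lra).
    apply Rdiv_lt_0_compat; nra. }
  assert (HB : 0 < B) by now apply sqrt_lt_R0.
  assert (HB2 : B ^ 2 = 2 / a - 2 * a) by (apply pow2_sqrt; lra).
  assert (Hu : forall b, 0 <= b < B -> 0 < u_gap a b).
  { intros b Hb. replace (u_gap a b) with ((B ^ 2 - b ^ 2) / 2); [nra|].
    rewrite HB2. unfold u_gap. field. lra. }
  destruct (last_crossings (winding a) B) as [L [HL [Hmon Hlim]]]; trivial.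
  { intros x Hx. apply winding_continuity; [lra | now apply Hu]. }
  { intros M HM. now apply winding_blowup. }
  (* From [kp] on, both levels 2k + 1 and 2k + 2 lie above the winding at b = 0, so their last
     crossings exist. *)
  destruct (INR_unbounded (winding a 0)) as [kp Hkp].
  assert (Hge : forall n, (kp <= n)%nat -> winding a 0 < INR n).
  { intros n Hn. apply le_INR in Hn. lra. }
  exists kp, (fun k => L (2 * k + 1)%nat), (fun k => L (2 * k + 2)%nat).
  split; [|split; [|split; [|split]]].
  - intros k Hk. destruct (HL (2 * k + 1)%nat) as [HLB E]; [apply Hge; lia|].
    apply (resonant_orbits a _ (2 * k + 1)); trivial; try lra. apply Hu. lra.
  - intros k Hk. destruct (HL (2 * k + 2)%nat) as [HLB E]; [apply Hge; lia|].
    apply (resonant_orbits a _ (2 * k + 2)); trivial; try lra. apply Hu. lra.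
  - apply is_lim_seq_Reals. intros eps He. destruct (Hlim eps He) as [N HN].
    exists N. intros n Hn. apply HN. lia.
  - apply is_lim_seq_Reals. intros eps He. destruct (Hlim eps He) as [N HN].
    exists N. intros n Hn. apply HN. lia.
  - intros k Hk. split; apply Hmon; try lia; apply Hge; lia.
Qed.

(** * Tools for arbitrary solutions: parabolic coordinates, first hits, comparison *)

(** The squared quantities are r p' and r q'. The Runge-Lenz relation removes the mixed term y vx
    vy, the energy relation removes the speed, and only polynomials in p and q remain. *)
Lemma parabolic_identity (a b E x y vx vy r : R) :
  0 < a -> 0 < r -> r * r = x ^ 2 + y ^ 2 ->
  E = b ^ 2 / 2 - 1 / a - a ->
  (vx ^ 2 + vy ^ 2) / 2 - 1 / r - x = E ->
  vy * (x * vy - y * vx) - x / r + y ^ 2 / 2 = a * b ^ 2 - 1 ->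
  let p := (r + x) / 2 in let q := (r - x) / 2 in
  (p * vx + y * vy / 2) ^ 2 = 2 * p * (p - a) * (p + a + E) /\
  (- q * vx + y * vy / 2) ^ 2 = 2 * q * (a * b ^ 2 / 2 + E * q - q ^ 2).
Proof.
  intros Ha Hr Hr2 HE Hen Hlrl p q.
  assert (Hx : x = p - q) by (unfold p, q; field).
  assert (Hrpq : r = p + q) by (unfold p, q; field).
  assert (Hy : y ^ 2 = 4 * p * q) by (unfold p, q; lra).
  assert (Hv : vx ^ 2 + vy ^ 2 = 2 * (E + 1 / r + x)) by lra.
  assert (Hw : y * vx * vy = x * vy ^ 2 - x / r + y ^ 2 / 2 + 1 - a * b ^ 2) by lra.
  (* The launch energy in the form that makes a a root of the cubic in p. *)
  assert (HEa : - E * a - a ^ 2 = 1 - a * b ^ 2 / 2) by (rewrite HE; field; lra).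
  split.
  - transitivity (p * (p * vx ^ 2 + y * vx * vy) + y ^ 2 * vy ^ 2 / 4); [field|].
    rewrite Hw, Hy.
    transitivity (p * (p * (vx ^ 2 + vy ^ 2) - x / r + 2 * p * q + 1 - a * b ^ 2)).
    { rewrite Hx. field. lra. }
    rewrite Hv.
    transitivity (2 * p * (p ^ 2 + E * p + (- E * a - a ^ 2))); [|ring].
    rewrite HEa. rewrite Hx, Hrpq. field. lra.
  - transitivity (q * (q * vx ^ 2 - y * vx * vy) + y ^ 2 * vy ^ 2 / 4); [field|].
    rewrite Hw, Hy.
    transitivity (q * (q * (vx ^ 2 + vy ^ 2) + x / r - 2 * p * q - 1 + a * b ^ 2)).
    { rewrite Hx. field. lra. }
    rewrite Hv, Hx, Hrpq. field. lra.
Qed.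

(** The time sought is the supremum of those t up to which [f] stays at or above [w]. *)
Lemma first_hit (f : R -> R) (w t1 : R) :
  (forall t, continuity_pt f t) -> w < f 0 -> 0 <= t1 -> f t1 < w ->
  exists t, 0 <= t <= t1 /\ f t = w /\ forall s, 0 <= s <= t -> w <= f s.
Proof.
  intros Hc H0 Ht1 H1.
  set (S := fun t => 0 <= t <= t1 /\ forall s, 0 <= s <= t -> w <= f s).
  destruct (completeness S) as [T [Hub Hlub]].
  { exists t1. intros t [Ht _]. lra. }
  { exists 0. split; [lra|]. intros s Hs. replace s with 0 by lra. lra. }
  assert (T0 : 0 <= T).
  { apply Hub. split; [lra|]. intros s Hs. replace s with 0 by lra. lra. }
  assert (T1 : T <= t1) by (apply Hlub; intros t [Ht _]; lra).
  assert (Hbelow : forall s, 0 <= s < T -> w <= f s).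
  { intros s Hs. destruct (Rle_dec w (f s)) as [H|H]; trivial. exfalso.
    assert (T <= s); [|lra]. apply Hlub. intros t [Ht Hts].
    destruct (Rle_dec t s) as [H'|H']; trivial. exfalso. apply H, Hts. lra. }
  assert (HT : f T = w).
  { destruct (Rtotal_order (f T) w) as [H|[H|H]]; trivial; exfalso.
    - assert (He : 0 < w - f T) by lra.
      destruct (proj1 (continuity_pt_locally _ _) (Hc T) (mkposreal _ He)) as [d Hd].
      assert (Hd0 := cond_pos d).
      destruct (Rle_lt_or_eq_dec _ _ T0) as [HT|HT]; [|rewrite <- HT in H; lra].
      assert (Hm : 0 < Rmin (d / 2) (T / 2)) by (apply Rmin_pos; lra).
      assert (B1 := Rmin_l (d / 2) (T / 2)). assert (B2 := Rmin_r (d / 2) (T / 2)).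
      set (x := T - Rmin (d / 2) (T / 2)).
      assert (Hx : Rabs (f x - f T) < w - f T).
      { apply Hd. apply Rabs_def1; unfold minus, plus, opp, x; simpl; lra. }
      apply Rabs_def2 in Hx. assert (w <= f x); [|lra].
      apply Hbelow. unfold x. lra.
    - assert (He : 0 < f T - w) by lra.
      destruct (proj1 (continuity_pt_locally _ _) (Hc T) (mkposreal _ He)) as [d Hd].
      assert (Hd0 := cond_pos d).
      destruct (Rle_lt_or_eq_dec _ _ T1) as [HT|HT]; [|rewrite HT in H; lra].
      assert (Hm : 0 < Rmin (d / 2) (t1 - T)) by (apply Rmin_pos; lra).
      assert (B1 := Rmin_l (d / 2) (t1 - T)). assert (B2 := Rmin_r (d / 2) (t1 - T)).
      assert (T + Rmin (d / 2) (t1 - T) <= T); [|lra].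
      apply Hub. split; [lra|]. intros s Hs.
      destruct (Rlt_dec s T) as [H'|H']; [apply Hbelow; lra|].
      assert (Hx : Rabs (f s - f T) < f T - w).
      { apply Hd. apply Rabs_def1; unfold minus, plus, opp; simpl; lra. }
      apply Rabs_def2 in Hx. lra. }
  exists T. split; [lra|]. split; trivial. intros s Hs.
  destruct (Rlt_dec s T) as [H|H]; [apply Hbelow; lra | replace s with T by lra; lra].
Qed.

(** Sturm comparison with z'' = -z/36, whose solution sin((t - c)/6) is nonnegative on an interval
    of length 6 PI. *)
Lemma sturm_zero (y vy g : R -> R) (c : R) :
  (forall t, is_derive y t (vy t)) -> (forall t, is_derive vy t (- g t * y t)) ->
  (forall t, c <= t <= c + 6 * PI -> 1 / 36 <= g t) ->
  exists t, c <= t <= c + 6 * PI /\ y t = 0.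
Proof.
  intros Hy Hvy Hg. assert (HPI := PI_RGT_0).
  assert (key : forall z vz : R -> R, (forall t, is_derive z t (vz t)) ->
    (forall t, is_derive vz t (- g t * z t)) ->
    ~ (forall t, c <= t <= c + 6 * PI -> 0 < z t)).
  { intros z vz Hz Hvz Hpos.
    (* The Wronskian is nondecreasing while z is positive, yet it equals z/6 > 0 at the left end and
       -z/6 < 0 at the right end. *)
    set (W := fun t => z t * (1 / 6 * cos ((t - c) / 6)) - vz t * sin ((t - c) / 6)).
    assert (H : W c <= W (c + 6 * PI)).
    { apply derive_nonneg_le with (fun t => (g t - 1 / 36) * (z t * sin ((t - c) / 6)));
        [lra| |].
      - intros t _. assert (Ez := is_derive_unique _ _ _ (Hz t)).
        assert (Ev := is_derive_unique _ _ _ (Hvz t)).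
        unfold W. auto_derive.
        + repeat split; eexists; [apply Hz | apply Hvz].
        + change (Derive (fun x => z x) t) with (Derive z t).
          change (Derive (fun x => vz x) t) with (Derive vz t).
          rewrite Ez, Ev. unfold Rdiv, Rminus. field.
      - intros t Ht. specialize (Hpos t Ht). specialize (Hg t Ht).
        assert (0 <= sin ((t - c) / 6)) by (apply sin_ge_0; lra).
        apply Rmult_le_pos; [lra|]. apply Rmult_le_pos; lra. }
    unfold W in H. replace ((c - c) / 6) with 0 in H by field.
    replace ((c + 6 * PI - c) / 6) with PI in H by field.
    rewrite cos_0, sin_0, cos_PI, sin_PI in H.
    assert (0 < z c) by (apply Hpos; lra).
    assert (0 < z (c + 6 * PI)) by (apply Hpos; lra). lra. }
  assert (Hcont : forall t, continuity_pt y t)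
    by (intros t; apply is_derive_continuity_pt with (vy t), Hy).
  apply Classical_Prop.NNPP. intros Hno.
  assert (Hne : forall t, c <= t <= c + 6 * PI -> y t <> 0)
    by (intros t Ht E; apply Hno; now exists t).
  destruct (Rlt_dec 0 (y c)) as [Hc|Hc].
  - apply (key y vy Hy Hvy). intros t Ht.
    destruct (Rlt_dec 0 (y t)) as [H|H]; trivial. exfalso.
    destruct (intermediate_value y c t 0) as [z [Hz E]]; try lra; trivial.
    apply (Hne z); lra.
  - apply (key (fun t => - y t) (fun t => - vy t)).
    + intros t. apply (is_derive_opp y), Hy.
    + intros t. apply is_derive_eq with (- (- g t * y t)); [|ring].
      apply (is_derive_opp vy), Hvy.
    + intros t Ht. destruct (Rlt_dec 0 (- y t)) as [H|H]; trivial. exfalso.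
      destruct (intermediate_value y c t 0) as [z [Hz E]]; try lra; trivial.
      apply (Hne z); lra.
Qed.

(** * Confinement near the saddle for a close to 1 *)

Section Confinement.

Variables (a b : R) (x y vx vy : R -> R).
Hypothesis a_range : 15 / 16 < a < 1.
Hypothesis sol : stark_solution (fun _ => True) x y vx vy.
Hypothesis init : init_cond a b x y vx vy.

Let r (t : R) : R := rad (x t) (y t).
Let E : R := b ^ 2 / 2 - 1 / a - a.
Let p (t : R) : R := (r t + x t) / 2.
Let q (t : R) : R := (r t - x t) / 2.
Let p1 (t : R) : R := ((x t * vx t + y t * vy t) / r t + vx t) / 2.

Lemma r_pos (t : R) : 0 < r t.
Proof. now apply sol. Qed.

Lemma r_sqr (t : R) : r t * r t = x t ^ 2 + y t ^ 2.
Proof.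
  apply sqrt_sqrt. generalize (pow2_ge_0 (x t)) (pow2_ge_0 (y t)). lra.
Qed.

Lemma is_derive_x (t : R) : is_derive x t (vx t).
Proof. now apply sol. Qed.

Lemma is_derive_y (t : R) : is_derive y t (vy t).
Proof. now apply sol. Qed.

Lemma is_derive_vx (t : R) : is_derive vx t (- x t / r t ^ 3 + 1).
Proof. now apply sol. Qed.

Lemma is_derive_vy (t : R) : is_derive vy t (- y t / r t ^ 3).
Proof. now apply sol. Qed.

Lemma is_derive_r (t : R) : is_derive r t ((x t * vx t + y t * vy t) / r t).
Proof.
  assert (Hr := r_pos t). assert (Hr2 := r_sqr t).
  assert (Hx := is_derive_x t). assert (Hy := is_derive_y t).
  assert (Ex := is_derive_unique _ _ _ Hx). assert (Ey := is_derive_unique _ _ _ Hy).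
  assert (Hpos : 0 < x t ^ 2 + y t ^ 2).
  { rewrite <- Hr2. now apply Rmult_lt_0_compat. }
  unfold r, rad in *. auto_derive.
  - repeat split; try (eexists; eassumption). simpl in Hpos. lra.
  - change (Derive (fun z => x z) t) with (Derive x t).
    change (Derive (fun z => y z) t) with (Derive y t).
    rewrite Ex, Ey. simpl in Hr |- *. field. lra.
Qed.

Lemma init_r : r 0 = a.
Proof.
  destruct init as (E1 & E2 & _). unfold r, rad. rewrite E1, E2.
  replace (a ^ 2 + 0 ^ 2) with (a ^ 2) by ring. apply sqrt_pow2. lra.
Qed.

Lemma energy_conserved (t : R) : (vx t ^ 2 + vy t ^ 2) / 2 - 1 / r t - x t = E.
Proof.
  set (f := fun t => (vx t ^ 2 + vy t ^ 2) / 2 - 1 / r t - x t).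
  change (f t = E). transitivity (f 0).
  - apply derive_zero_const. intros z.
    assert (Hr := r_pos z).
    assert (Hx := is_derive_x z). assert (Hvx := is_derive_vx z).
    assert (Hvy := is_derive_vy z). assert (Hdr := is_derive_r z).
    assert (Ex := is_derive_unique _ _ _ Hx).
    assert (Evx := is_derive_unique _ _ _ Hvx).
    assert (Evy := is_derive_unique _ _ _ Hvy).
    assert (Er := is_derive_unique _ _ _ Hdr).
    unfold f. auto_derive.
    + repeat split; try (eexists; eassumption). lra.
    + change (Derive (fun s => x s) z) with (Derive x z).
      change (Derive (fun s => vx s) z) with (Derive vx z).
      change (Derive (fun s => vy s) z) with (Derive vy z).
      change (Derive (fun s => r s) z) with (Derive r z).
      rewrite Ex, Evx, Evy, Er. field. lra.
  - destruct init as (E1 & E2 & E3 & E4). unfold f. rewrite init_r, E1, E3, E4.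
    unfold E. field. lra.
Qed.

(* The x-component of the Laplace-Runge-Lenz vector, corrected for the uniform field. *)
Lemma runge_lenz_conserved (t : R) :
  vy t * (x t * vy t - y t * vx t) - x t / r t + y t ^ 2 / 2 = a * b ^ 2 - 1.
Proof.
  set (f := fun t => vy t * (x t * vy t - y t * vx t) - x t / r t + y t ^ 2 / 2).
  change (f t = a * b ^ 2 - 1). transitivity (f 0).
  - apply derive_zero_const. intros z.
    assert (Hr := r_pos z). assert (Hr2 := r_sqr z).
    assert (Hx := is_derive_x z). assert (Hy := is_derive_y z).
    assert (Hvx := is_derive_vx z).
    assert (Hvy := is_derive_vy z). assert (Hdr := is_derive_r z).
    assert (Ex := is_derive_unique _ _ _ Hx).
    assert (Ey := is_derive_unique _ _ _ Hy).
    assert (Evx := is_derive_unique _ _ _ Hvx).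
    assert (Evy := is_derive_unique _ _ _ Hvy).
    assert (Er := is_derive_unique _ _ _ Hdr).
    unfold f. auto_derive.
    + repeat split; try (eexists; eassumption). lra.
    + change (Derive (fun s => x s) z) with (Derive x z).
      change (Derive (fun s => y s) z) with (Derive y z).
      change (Derive (fun s => vx s) z) with (Derive vx z).
      change (Derive (fun s => vy s) z) with (Derive vy z).
      change (Derive (fun s => r s) z) with (Derive r z).
      rewrite Ex, Ey, Evx, Evy, Er.
      transitivity (vx z * (x z ^ 2 + y z ^ 2 - r z * r z) / r z ^ 3); [field; lra|].
      rewrite Hr2. unfold Rminus. rewrite Rplus_opp_r. field. lra.
  - destruct init as (E1 & E2 & E3 & E4). unfold f. rewrite init_r, E1, E2, E3, E4.
    field. lra.
Qed.

Lemma p_identity (t : R) : (r t * p1 t) ^ 2 = 2 * p t * (p t - a) * (p t + a + E).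
Proof.
  destruct (parabolic_identity a b E (x t) (y t) (vx t) (vy t) (r t)) as [H _];
    trivial; try lra.
  - apply r_pos.
  - apply r_sqr.
  - apply energy_conserved.
  - apply runge_lenz_conserved.
  - unfold p. rewrite <- H. assert (Hr := r_pos t). unfold p1. field. lra.
Qed.

Lemma q_identity (t : R) : 0 <= 2 * q t * (a * b ^ 2 / 2 + E * q t - q t ^ 2).
Proof.
  destruct (parabolic_identity a b E (x t) (y t) (vx t) (vy t) (r t)) as [_ H];
    trivial; try lra.
  - apply r_pos.
  - apply r_sqr.
  - apply energy_conserved.
  - apply runge_lenz_conserved.
  - unfold q. rewrite <- H. apply pow2_ge_0.
Qed.

Lemma pq_nonneg (t : R) : 0 <= p t /\ 0 <= q t.
Proof.
  assert (Hr := r_pos t). assert (Hr2 := r_sqr t). assert (Hy := pow2_ge_0 (y t)).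
  unfold p, q. split; nra.
Qed.

Lemma is_derive_p (t : R) : is_derive p t (p1 t).
Proof.
  assert (Hx := is_derive_x t). assert (Hdr := is_derive_r t).
  assert (Ex := is_derive_unique _ _ _ Hx). assert (Er := is_derive_unique _ _ _ Hdr).
  unfold p. auto_derive.
  - repeat split; eexists; eassumption.
  - change (Derive (fun s => x s) t) with (Derive x t).
    change (Derive (fun s => r s) t) with (Derive r t).
    rewrite Ex, Er. unfold p1. field. generalize (r_pos t). lra.
Qed.

Lemma p_continuity (t : R) : continuity_pt p t.
Proof. eapply is_derive_continuity_pt, is_derive_p. Qed.

Lemma init_p : p 0 = a.
Proof.
  destruct init as (E1 & _). unfold p. rewrite init_r, E1. field.
Qed.

Lemma p_value_allowed (t w : R) : p t = w -> 0 <= w * (w - a) * (w + a + E).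
Proof.
  intros <-. generalize (p_identity t) (pow2_ge_0 (r t * p1 t)). lra.
Qed.

(** The cubic of [p_identity] is negative between max(0, -a - E) and a, so p cannot descend through
    this gap; [w] is its midpoint. *)
Lemma p_positive_high_energy (t : R) : - 2 * a < E -> 0 <= t -> 0 < p t.
Proof.
  intros HE Ht. destruct (Rlt_dec 0 (p t)) as [H|H]; trivial. exfalso.
  set (w := (a + Rmax 0 (- a - E)) / 2).
  assert (M0 := Rmax_l 0 (- a - E)). assert (M1 := Rmax_r 0 (- a - E)).
  assert (M2 : Rmax 0 (- a - E) < a) by (apply Rmax_lub_lt; lra).
  destruct (intermediate_value p 0 t w) as [z [_ Hz]]; trivial.
  - apply p_continuity.
  - rewrite init_p. unfold w. lra.
  - apply p_value_allowed in Hz.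
    assert (0 < w * (a - w)) by (apply Rmult_lt_0_compat; unfold w; lra).
    assert (0 < w * (a - w) * (w + a + E)) by (apply Rmult_lt_0_compat; unfold w in *; lra).
    lra.
Qed.

(** Here the saddle -a - E lies above a and the cubic is negative in between, so p cannot climb
    through this gap. *)
Lemma p_below (t : R) : E < - 2 * a -> 0 <= t -> p t <= a.
Proof.
  intros HE Ht. destruct (Rle_dec (p t) a) as [H|H]; trivial. exfalso.
  set (w := (a + Rmin (p t) (- a - E)) / 2).
  assert (M0 := Rmin_l (p t) (- a - E)). assert (M1 := Rmin_r (p t) (- a - E)).
  assert (M2 : a < Rmin (p t) (- a - E)) by (apply Rmin_glb_lt; lra).
  destruct (intermediate_value p 0 t w) as [z [_ Hz]]; trivial.
  - apply p_continuity.
  - rewrite init_p. unfold w. lra.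
  - apply p_value_allowed in Hz.
    assert (0 < w * (w - a)) by (apply Rmult_lt_0_compat; unfold w; lra).
    assert (0 < w * (w - a) * (- w - a - E))
      by (apply Rmult_lt_0_compat; unfold w in *; lra).
    lra.
Qed.

(* Distance to the saddle u^2 = sigma of the regularised potential grows at most
   exponentially as long as p stays away from 0. *)
Lemma saddle_distance (t : R) : E <= - 2 * a -> 0 <= t ->
  (forall s, 0 <= s <= t -> 1 / 2 <= p s) ->
  (- a - E - p t) ^ 2 <= (1 / a - a) ^ 2 * exp (4 * t).
Proof.
  intros HE Ht Hp. set (sigma := - a - E).
  (* Gronwall in monotone form: [g] is nondecreasing as soon as |p'| <= 2 |sigma - p|. *)
  set (g := fun s => - (sigma - p s) ^ 2 * exp (- (4 * s))).
  assert (H : g 0 <= g t).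
  { apply derive_nonneg_le with
      (fun s => (4 * (sigma - p s) ^ 2 + 2 * (sigma - p s) * p1 s) * exp (- (4 * s)));
      trivial.
    - intros s _. assert (Hd := is_derive_p s).
      assert (Ed := is_derive_unique _ _ _ Hd). unfold g. auto_derive.
      + repeat split; eexists; eassumption.
      + change (Derive (fun z => p z) s) with (Derive p s). rewrite Ed. ring.
    - intros s Hs. apply Rmult_le_pos; [|apply Rlt_le, exp_pos].
      assert (Hps := Hp s Hs). assert (Hid := p_identity s).
      assert (Hr := r_pos s). destruct (pq_nonneg s) as [_ Hq].
      assert (Hrp : p s <= r s) by (unfold p, q in *; lra).
      set (d := sigma - p s).
      (* Below the critical energy p <= a < sigma, so a - p <= sigma - p; at the critical energy
         sigma = a and equality holds. *)
      assert (Hd : (p s - a) * (p s + a + E) <= d ^ 2).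
      { unfold d, sigma. destruct (Rle_lt_or_eq_dec _ _ HE) as [H|H].
        - assert (p s <= a) by (apply p_below; lra). nra.
        - replace E with (- 2 * a) by lra. apply Req_le. ring. }
      assert (H1 : p s ^ 2 * p1 s ^ 2 <= 2 * p s * d ^ 2).
      { apply Rle_trans with ((r s * p1 s) ^ 2).
        - rewrite Rpow_mult_distr. apply Rmult_le_compat_r; [apply pow2_ge_0|].
          apply pow_incr. lra.
        - rewrite Hid, (Rmult_assoc (2 * p s)). apply Rmult_le_compat_l; lra. }
      assert (H2 : p s * p1 s ^ 2 <= 2 * d ^ 2).
      { apply Rmult_le_reg_l with (p s); lra. }
      assert (H3 : p1 s ^ 2 <= (2 * d) ^ 2) by (generalize (pow2_ge_0 (p1 s)); nra).
      assert (H4 : Rabs (p1 s) <= Rabs (2 * d)) by (apply Rsqr_le_abs_0; unfold Rsqr; lra).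
      assert (H5 : Rabs (2 * d * p1 s) <= 4 * d ^ 2).
      { rewrite Rabs_mult. apply Rle_trans with (Rabs (2 * d) * Rabs (2 * d)).
        - apply Rmult_le_compat_l; trivial. apply Rabs_pos.
        - rewrite <- Rabs_mult, Rabs_pos_eq; [lra|]. nra. }
      generalize (Rle_abs (- (2 * d * p1 s))). rewrite Rabs_Ropp. lra. }
  unfold g in H. rewrite Rmult_0_r, Ropp_0, exp_0, init_p, exp_Ropp in H.
  assert (He := exp_pos (4 * t)).
  apply Rle_trans with ((sigma - a) ^ 2 * exp (4 * t)).
  - apply Rmult_le_reg_r with (/ exp (4 * t)); [now apply Rinv_0_lt_compat|].
    rewrite Rmult_assoc, Rinv_r by lra. lra.
  - apply Rmult_le_compat_r; [lra|]. apply pow_incr. unfold sigma, E in *.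
    generalize (pow2_ge_0 b). lra.
Qed.

(** A bootstrap: up to a first time with p = 1/2, [saddle_distance] keeps p within 1/4 of the
    saddle, which is at least a > 15/16, a contradiction. The bound on r = p + q follows from p <
    5/4 + 1/4 and q <= 1. *)
Lemma confined (L t : R) : E <= - 2 * a -> (1 / a - a) ^ 2 * exp (4 * L) < 1 / 16 ->
  0 <= t <= L -> 1 / 2 <= p t /\ r t <= 3.
Proof.
  intros HE HL Ht.
  assert (Hdist : forall t, 0 <= t <= L -> (forall s, 0 <= s <= t -> 1 / 2 <= p s) ->
            - a - E - p t < 1 / 4 /\ p t - (- a - E) < 1 / 4).
  { intros s Hs Hps. assert (H := saddle_distance s HE (proj1 Hs) Hps).
    assert (exp (4 * s) <= exp (4 * L)).
    { destruct (Rle_lt_or_eq_dec _ _ (proj2 Hs)) as [H'|H'].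
      - apply Rlt_le, exp_increasing. lra.
      - rewrite H'. lra. }
    assert (Hsq : (- a - E - p s) ^ 2 < (1 / 4) ^ 2).
    { generalize (pow2_ge_0 (1 / a - a)). nra. }
    set (d := - a - E - p s) in *. replace (p s - (- a - E)) with (- d) by (unfold d; ring).
    split; nra. }
  assert (Hp : forall t, 0 <= t <= L -> 1 / 2 <= p t).
  { intros s Hs. destruct (Rle_dec (1 / 2) (p s)) as [H|H]; trivial. exfalso.
    destruct (first_hit p (1 / 2) s) as (z & Hz & Ez & Hbelow); try lra.
    - apply p_continuity.
    - rewrite init_p. lra.
    - destruct (Hdist z) as [H1 _]; trivial; lra. }
  split; [now apply Hp|].
  destruct (Hdist t Ht) as [_ H]; [intros; apply Hp; lra|].
  assert (Hq := q_identity t). destruct (pq_nonneg t) as [_ Hq0].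
  assert (Hainv : 1 / a < 5 / 4).
  { apply Rmult_lt_reg_r with a; [lra|]. unfold Rdiv at 1.
    rewrite Rmult_assoc, Rinv_l; lra. }
  assert (Hb := pow2_ge_0 b).
  assert (Hb1 : a * b ^ 2 / 2 <= 1) by (unfold E in HE; nra).
  (* For q > 1 the right side of [q_identity] would be negative, since E < 0 and a b^2 / 2 <= 1. *)
  assert (Hq1 : q t <= 1).
  { destruct (Rle_dec (q t) 1) as [H'|H']; trivial. exfalso.
    assert (0 < q t * (q t ^ 2 - E * q t - a * b ^ 2 / 2)); [|lra].
    apply Rmult_lt_0_compat; nra. }
  replace (r t) with (p t + q t) by (unfold p, q; field). unfold E in *. lra.
Qed.

Lemma many_zeros (L : R) (n : nat) : E <= - 2 * a ->
  (1 / a - a) ^ 2 * exp (4 * L) < 1 / 16 -> 25 * INR n <= L ->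
  exists l, NoDup l /\ length l = n /\
    forall t, In t l -> 0 < t < 25 * INR n /\ y t = 0 /\ 0 < x t.
Proof.
  intros HE HL. induction n as [|n IH]; intros Hn.
  - exists nil. split; [apply NoDup_nil | split; [reflexivity | intros t []]].
  - rewrite S_INR in Hn. destruct IH as (l & Hnd & Hlen & Hl); [lra|].
    assert (HPI := PI_RGT_0). assert (HPI4 := PI_4). assert (Hn0 := pos_INR n).
    (* Since 6 PI <= 24, the comparison interval lies strictly inside the window from 25n to 25(n +
       1), so the new zero differs from the earlier ones. The bound r <= 3 gives 1/r^3 >= 1/27 >
       1/36. *)
    destruct (sturm_zero y vy (fun t => / r t ^ 3) (25 * INR n + 1 / 2))
      as (t & Ht & Hy).
    + apply is_derive_y.
    + intros t. eapply is_derive_eq; [apply is_derive_vy|].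
      assert (Hr := r_pos t). field. lra.
    + intros t Ht. destruct (confined L t HE HL) as [_ Hr3]; [lra|].
      assert (Hr := r_pos t). replace (1 / 36) with (/ 36) by field.
      apply Rinv_le_contravar; [now apply pow_lt|].
      apply Rle_trans with (3 ^ 3); [apply pow_incr|]; lra.
    + exists (t :: l). split; [|split].
      * constructor; trivial. intros Hin. apply Hl in Hin. lra.
      * simpl. now rewrite Hlen.
      * intros z [<-|Hin].
        -- rewrite S_INR. split; [lra|]. split; trivial.
           destruct (confined L t HE HL) as [Hp _]; [lra|].
           assert (Hr := r_pos t). assert (Hr2 := r_sqr t). rewrite Hy in Hr2.
           unfold p in Hp. nra.
        -- rewrite S_INR. destruct (Hl z Hin) as (H1 & H2 & H3). repeat split; lra.
Qed.

(** On the negative axis p = 0. This excludes high energy and, by confinement, forces T > 25 N; the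
    [N] zeros found before that time are then among the [k] crossings. *)
Lemma periodic_crossings_lower (k N : nat) (T : R) :
  (1 / a - a) ^ 2 * exp (4 * (25 * INR N)) < 1 / 16 -> 0 < T -> y T = 0 -> x T < 0 ->
  exactly_k_times (fun t => 0 < t < T /\ y t = 0 /\ 0 < x t) k -> (N <= k)%nat.
Proof.
  intros HN HT HyT HxT [ts [_ Hts]].
  assert (HpT : p T = 0).
  { assert (Hr := r_pos T). assert (Hr2 := r_sqr T). rewrite HyT in Hr2.
    unfold p. nra. }
  destruct (Rle_dec E (- 2 * a)) as [HE|HE].
  2: { assert (0 < p T) by (apply p_positive_high_energy; lra). lra. }
  destruct (many_zeros (25 * INR N) N HE HN) as (l & Hnd & Hlen & Hl); [lra|].
  assert (HLT : 25 * INR N < T).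
  { destruct (Rlt_dec (25 * INR N) T) as [H|H]; trivial. exfalso.
    destruct (confined _ T HE HN); lra. }
  rewrite <- Hlen, <- (length_seq k 0), <- (length_map ts).
  apply NoDup_incl_length; trivial. intros t Hin.
  destruct (Hl t Hin) as (H1 & H2 & H3).
  destruct (proj1 (Hts t)) as (i & Hi & ->); [repeat split; lra|].
  apply in_map, in_seq. lia.
Qed.

End Confinement.

Lemma periodic_crossings_unbounded (N : nat) : exists delta, 0 < delta /\
  forall a b k, 1 - delta < a < 1 -> periodic_orbit_k a b k -> (N <= k)%nat.
Proof.
  (* Then 1/a - a <= 3(1 - a) up to this size gives (1/a - a)^2 exp(4L) <= 9/256 < 1/16; also a >
     15/16, as the exponential is at most 1. *)
  set (L := 25 * INR N). exists (exp (- (2 * L)) / 16).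
  assert (He := exp_pos (- (2 * L))). split; [lra|].
  intros a b k Ha (x & y & vx & vy & Hsol & Hinit & _ & T & HT & Hk & _ & HyT & HxT & _).
  assert (He1 : exp (- (2 * L)) <= 1).
  { rewrite <- exp_0. assert (0 <= L) by (unfold L; generalize (pos_INR N); lra).
    destruct (Req_dec L 0) as [->|H'].
    - rewrite Rmult_0_r, Ropp_0. lra.
    - apply Rlt_le, exp_increasing. lra. }
  apply periodic_crossings_lower with a b x y vx vy T; trivial; [lra|].
  fold L. set (e := exp (- (2 * L))) in *.
  assert (Ee : e * e * exp (4 * L) = 1).
  { unfold e. rewrite <- !exp_plus. replace (- (2 * L) + - (2 * L) + 4 * L) with 0 by ring.
    apply exp_0. }
  assert (H1 : 0 < 1 / a - a < 3 * (e / 16)).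
  { replace (1 / a - a) with ((1 - a) * (1 + a) / a) by (field; lra). split.
    - apply Rdiv_lt_0_compat; nra.
    - apply Rmult_lt_reg_r with a; [lra|]. unfold Rdiv at 1.
      rewrite Rmult_assoc, Rinv_l by lra. nra. }
  assert (H2 : (1 / a - a) ^ 2 <= (3 * (e / 16)) ^ 2) by (apply pow_incr; lra).
  assert (H3 := exp_pos (4 * L)).
  apply Rle_lt_trans with ((3 * (e / 16)) ^ 2 * exp (4 * L)); [nra|].
  replace ((3 * (e / 16)) ^ 2 * exp (4 * L)) with (9 / 256 * (e * e * exp (4 * L)))
    by field.
  rewrite Ee. lra.
Qed.

Theorem theorem1p3 :
  (forall a : R, 0 < a < 1 ->
     exists (kp : nat) (b b' : nat -> R), stark_families a kp b b') /\
  (* lim_{a -> 1} k_p(a) = +oo, with k_p(a) the least admissible k_p: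
     for every N, all admissible k_p are >= N when a is close enough to 1 *)
  (forall N : nat, exists delta : R, 0 < delta /\
     forall a : R, 1 - delta < a < 1 ->
       forall kp : nat, (exists b b' : nat -> R, stark_families a kp b b') ->
         (N <= kp)%nat).
Proof.
  split; [exact stark_families_exist|].
  intros N. destruct (periodic_crossings_unbounded N) as [delta [Hd H]].
  exists delta. split; trivial. intros a Ha kp [b [b' [Hper _]]].
  (* The first member of an admissible family is itself a periodic orbit with exactly [kp]
     crossings. *)
  apply (H a (b kp) kp Ha). apply Hper. lia.
Qed.
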